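(* Let $d\ge1$. Each of the following is a positive class on $\mathbb B^d$: (1) $M^+$, consisting of all functions of the form $f(z)=\rho(H(z,Z))+i\,\Im f(0)$, where $\rho$ is a positive linear functional on $C(\partial\mathbb B^d)$; (2) $R^+$, consisting of all functions of the form $f(z)=\rho(H(z,S))+i\,\Im f(0)$, where $\rho$ is a positive linear functional on $\mathcal T_d$; (3) $S^+$, consisting of all functions of the form $f(z)=\rho(H(z,V))+i\,\Im f(0)$, where $\rho$ is a positive linear functional on $\mathcal O_d$.
   Context: $\mathbb B^d$ is the open unit ball of $\mathbb C^d$, $O$ is the space of holomorphic functions on $\mathbb B^d$ with the topology of uniform convergence on compact subsets, and $O^+\subset O$ is the set of functions with nonnegative real part. A positive class on $\mathbb B^d$ is a set $\mathcal P\subset O^+$ which is a closed convex cone in $O$ and is closed under dilations: if $f\in\mathcal P$ then $f_r\in\mathcal P$ for all $0\le r\le1$, where $f_r(z)=f(rz)$. For a $d$-tuple $T=(T_1,\dots,T_d)$ of elements of a unital C*-algebra with $\sum_j T_jT_j^*\le I$ (a row contraction) and $z\in\mathbb B^d$, set $H(z,T)=2\bigl(I-\sum_{j=1}^d z_jT_j\bigr)^{-1}-I$. $Z=(Z_1,\dots,Z_d)$ are the coordinate functions $\zeta_1,\dots,\zeta_d$ in $C(\partial\mathbb B^d)$. $S=(S_1,\dots,S_d)$, where $S_j$ is multiplication by $z_j$ on the Drury–Arveson space $H^2_d$, the reproducing kernel Hilbert space on $\mathbb B^d$ with kernel $1/(1-\sum_j z_j\overline{w_j})$; $\mathcal T_d$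 is the unital C*-algebra generated by $S_1,\dots,S_d$. $V=(V_1,\dots,V_d)$ are the generators of the Cuntz algebra $\mathcal O_d$, the universal unital C*-algebra generated by elements satisfying $V_i^*V_j=\delta_{ij}I$ and $\sum_{j=1}^d V_jV_j^*=I$. The term $i\,\Im f(0)$ means that an arbitrary imaginary constant may be added. *)

(* Defs.v *)
From HB Require Import structures.
From mathcomp Require Import all_boot all_order all_algebra sesquilinear.
From mathcomp Require Import complex.
From mathcomp Require Import all_classical all_reals topology normedtype derive.
From mathcomp Require Import ring lra.
Set Implicit Arguments.
Unset Strict Implicit.
Unset Printing Implicit Defensive.
Import Order.TTheory GRing.Theory Num.Theory.
Import numFieldNormedType.Exports.
Local Open Scope classical_set_scope.
Local Open Scope ring_scope.
Local Open Scope complex_scope.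

Local Notation Re := complex.Re.
Local Notation Im := complex.Im.

HB.instance Definition _ (R : realType) := NormedModule.copy R[i] R[i]^o.

(* Complex Hilbert spaces, with an inner product that is linear in its first
   argument. They are required to be nonzero, because the bounded operators
   below have to form an algType, in which 1 != 0. *)
HB.mixin Record isHilbert (R : realType) H & CompleteNormedModule R[i] H := {
  hdot : {dot H for (@Num.conj R[i])} ;
  hdot_norm : forall u : H, `|u| ^+ 2 = hdot u u ;
  hilbert_neq0 : exists u : H, u != 0 }.

#[short(type="hilbertType")]
HB.structure Definition Hilbert (R : realType) :=
  {H of isHilbert R H & CompleteNormedModule R[i] H}.

(* Unital complex *-algebras. *)
HB.mixin Record isStarAlgebra (R : realType) A
    & GRing.Algebra R[i] A := {
  star : A -> A ;
  starK : involutive star ;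
  starD : forall x y, star (x + y) = star x + star y ;
  starZ : forall (c : R[i]) x, star (c *: x) = c^* *: star x ;
  starM : forall x y, star (x * y) = star y * star x }.

#[short(type="starAlgType")]
HB.structure Definition StarAlgebra (R : realType) :=
  {A of isStarAlgebra R A & GRing.Algebra R[i] A}.

(* Unital C*-algebras. The norm is a separate operation, not the one of
   normedModType: a structure inheriting from both algType and normedModType
   would conflict with the existing join numDomainType of rings and normed
   Z-modules. *)
HB.mixin Record isCStarAlgebra (R : realType) A & StarAlgebra R A := {
  cnorm : A -> R ;
  cnormD : forall x y, cnorm (x + y) <= cnorm x + cnorm y ;
  cnormZ : forall (c : R[i]) x, (cnorm (c *: x))%:C = `|c| * (cnorm x)%:C ;
  cnorm_eq0 : forall x, cnorm x = 0 -> x = 0 ;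
  cnormM : forall x y, cnorm (x * y) <= cnorm x * cnorm y ;
  cnorm_star : forall x, cnorm (star x * x) = cnorm x ^+ 2 ;
  cnorm_complete : forall x : nat -> A,
    (forall e : R, 0 < e -> exists N, forall m n, (N <= m)%N -> (N <= n)%N ->
       cnorm (x m - x n) < e) ->
    exists l, (cnorm (x n - l)) @[n --> \oo] --> (0 : R) }.

#[short(type="cstarAlgType")]
HB.structure Definition CStarAlgebra (R : realType) :=
  {A of isCStarAlgebra R A & StarAlgebra R A}.

Section HilbertTheory.
Variables (R : realType) (H : hilbertType R).
Implicit Types (u v w : H) (a : R[i]).
Local Notation dot := (@hdot R H).

Lemma dotC u v : dot u v = (dot v u)^*%R.
Proof. by rewrite hermC expr0 mul1r. Qed.

Lemma dotDl u v w : dot (u + v) w = dot u w + dot v w.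
Proof. by rewrite linearDl. Qed.

Lemma dotDr u v w : dot w (u + v) = dot w u + dot w v.
Proof. by rewrite linearDr. Qed.

Lemma dotZl a u w : dot (a *: u) w = a * dot u w.
Proof. by rewrite linearZl_LR. Qed.

Lemma dotZr a u w : dot w (a *: u) = a^*%R * dot w u.
Proof. by rewrite linearZr_LR. Qed.

Lemma dotNl u w : dot (- u) w = - dot u w.
Proof. by rewrite linearNl. Qed.

Lemma dotNr u w : dot w (- u) = - dot w u.
Proof. by rewrite linearNr. Qed.

Lemma dotBl u v w : dot (u - v) w = dot u w - dot v w.
Proof. by rewrite dotDl dotNl. Qed.

Lemma dotBr u v w : dot w (u - v) = dot w u - dot w v.
Proof. by rewrite dotDr dotNr. Qed.

Lemma dot0l u : dot 0 u = 0.
Proof. by rewrite -(scale0r (0 : H)) dotZl mul0r. Qed.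

Lemma dot0r u : dot u 0 = 0.
Proof. by rewrite dotC dot0l conjC0. Qed.

Lemma dot_ge0 u : 0 <= dot u u.
Proof. by rewrite -hdot_norm exprn_ge0. Qed.

Lemma dot_eq0 u : (dot u u == 0) = (u == 0).
Proof. by rewrite -hdot_norm sqrf_eq0 normr_eq0. Qed.

Lemma dot_inj u v : (forall w, dot w u = dot w v) -> u = v.
Proof.
move=> uv; apply/eqP; rewrite -subr_eq0 -dot_eq0 dotBr; apply/eqP.
by rewrite uv subrr.
Qed.

Lemma dot_min u v a : (forall t, a <= dot (u - t *: v) (u - t *: v)) ->
  `|dot u v| ^+ 2 <= (dot u u - a) * dot v v.
Proof.
move=> min; have [->|v0] := eqVneq v 0.
  by rewrite !dot0r normr0 expr0n mulr0.
have D0 : 0 < dot v v by rewrite lt_def dot_eq0 v0 dot_ge0.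
have := min (dot u v / dot v v).
rewrite dotBl !dotBr !dotZl !dotZr (dotC v u) fmorph_div /=.
rewrite (geC0_conj (dot_ge0 v)) -subr_ge0.
set p := dot u v; set D := dot v v => h.
rewrite -subr_ge0.
have -> : (dot u u - a) * D - `|p| ^+ 2 =
  D * (dot u u - p^*%R / D * p - (p / D * p^*%R - p / D * (p^*%R / D * D)) - a).
  by rewrite normCK; field; rewrite gt_eqF.
by rewrite mulr_ge0 // ltW.
Qed.

Lemma dot_CS u v : `|dot u v| <= `|u| * `|v|.
Proof.
rewrite -(@ler_pXn2r _ 2) ?nnegrE ?mulr_ge0 ?normr_ge0 // exprMn !hdot_norm.
have := @dot_min u v 0 (fun=> dot_ge0 _); by rewrite subr0.
Qed.

Lemma parallelogram u v :
  dot (u - v) (u - v) = 2 * dot u u + 2 * dot v v - dot (u + v) (u + v).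
Proof. by rewrite !(dotBl, dotDl) !(dotBr, dotDr); ring. Qed.

Lemma dot_Re u : dot u u = (Re (dot u u))%:C.
Proof. by rewrite RRe_real // ger0_real // dot_ge0. Qed.

Lemma norm_small (k : R) (z : R[i]) :
  (forall e : R, 0 < e -> `|z| <= (k * e)%:C) -> z = 0.
Proof.
move=> small; apply/eqP; rewrite -normr_eq0; apply: contraT => z0.
have nz : `|z| = (Re `|z|)%:C by rewrite RRe_real // normr_real.
have pz : 0 < Re `|z| by rewrite -ltcR -nz lt_def z0 normr_ge0.
have k0 : 0 < k.
  by have := small 1 ltr01; rewrite mulr1 nz lecR; apply: lt_le_trans.
have := small (Re `|z| / (2 * k)); rewrite divr_gt0 ?mulr_gt0 // => /(_ isT).
rewrite nz lecR; have -> : k * (Re `|z| / (2 * k)) = Re `|z| / 2.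
  by field; rewrite gt_eqF.
by move: pz; lra.
Qed.

(* Riesz representation theorem, which provides the adjoints below. *)
Lemma riesz (phi : {scalar H}) (c : R) :
  (forall u, `|phi u| <= c%:C * `|u|) -> exists y, forall u, phi u = dot u y.
Proof.
move=> phic; have [[u0 phi0]|nphi] := pselect (exists u, phi u != 0); last first.
  exists 0 => u; rewrite dot0r; apply/eqP/negPn/negP => phiu.
  by apply: nphi; exists u.
pose A : set H := [set u | phi u = 1].
pose q u : R := Re (dot u u).
have q0 u : 0 <= q u by rewrite -lecR -dot_Re dot_ge0.
have Aq : has_inf (q @` A).
  split; last by exists 0 => _ [u _ <-].
  by exists (q ((phi u0)^-1 *: u0)); exists ((phi u0)^-1 *: u0) => //=;
    rewrite /A /= linearZ /= mulVf.
set m := inf (q @` A).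
have mq u : A u -> m <= q u by move=> Au; apply: ge_inf; [case: Aq|exists u].
have apx n : exists u, A u /\ q u < m + n.+1%:R^-1.
  have [|_ [u Au <-] um] := @inf_adherent _ (q @` A) n.+1%:R^-1 _ Aq.
    by rewrite invr_gt0.
  by exists u.
have [x xP] := choice apx.
have xA n : A (x n) by case: (xP n).
have xq n : q (x n) < m + n.+1%:R^-1 by case: (xP n).
have xx N n : (N <= n)%N -> q (x N - x n) <= 4 * N.+1%:R^-1.
  move=> Nn.
  have par : q (x N - x n) = 2 * q (x N) + 2 * q (x n) - q (x N + x n).
    apply: complexI; rewrite !(rmorphB, rmorphD, rmorphM, rmorph_nat) /=.
    by rewrite /q -!dot_Re parallelogram.
  have half : 4 * m <= q (x N + x n).
    have -> : q (x N + x n) = 4 * q (2^-1 *: (x N + x n)).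
      apply: complexI; rewrite rmorphM rmorph_nat /= /q -!dot_Re dotZl dotZr.
      by rewrite (@geC0_conj _ (2^-1)) ?invr_ge0 //; field.
    rewrite ler_pM2l // mq //. rewrite /A /= linearZ /=. rewrite linearD /= !xA.
    by rewrite -mulr2n mulVf // pnatr_eq0.
  have := xq N; have := xq n; rewrite par.
  have : n.+1%:R^-1 <= N.+1%:R^-1 :> R by rewrite lef_pV2 ?posrE // ler_nat.
  move: half; move: (q _) (q _) (q _) (_^-1) (_^-1) => a b cc dd ee. by move=> *; lra.
have xcvg : cvg (x @ \oo).
  apply: cauchy_cvg; apply: cauchy_exP => e e0.
  have eE : e = (Re e)%:C by rewrite RRe_real // gtr0_real.
  have re0 : 0 < Re e by rewrite -ltcR -eE.
  pose N := Num.truncn (4 / (Re e) ^+ 2).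
  have NP : 4 / (Re e) ^+ 2 < N.+1%:R by exact: truncnS_gt.
  exists (x N); exists N => // n /= /xx xNn.
  rewrite -ball_normE /ball_ /=.
  rewrite -(@ltr_pXn2r _ 2) ?nnegrE ?normr_ge0 ?ltW //.
  rewrite hdot_norm dot_Re eE -rmorphXn ltcR.
  apply: (le_lt_trans xNn).
  by rewrite ltr_pdivrMr // -ltr_pdivrMl ?exprn_gt0 // mulrC.
set l := lim (x @ \oo) in xcvg.
have close (e : R) : 0 < e -> exists n, `|l - x n| <= e%:C /\ n.+1%:R^-1 <= e.
  move=> e0; have /cvgrPdist_le/(_ e%:C) : x @ \oo --> l by [].
  rewrite ltcR => /(_ e0) [N _ NP].
  pose M := Num.truncn (e^-1).
  exists (maxn N M); split; first by apply: NP; rewrite /= leq_maxl.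
  rewrite invf_ple ?posrE //.
  by rewrite (le_trans (ltW (truncnS_gt _))) // ler_nat ltnS leq_maxr.
have phil : phi l = 1.
  apply/eqP; rewrite -subr_eq0; apply/eqP/(@norm_small c) => e e0.
  have [n [ln _]] := close _ e0; rewrite -(xA n) -linearB rmorphM.
  apply: le_trans (phic _) _; apply: ler_wpM2l ln.
  have := le_trans (normr_ge0 _) (phic u0).
  have pu0 : 0 < `|u0|.
    by rewrite normr_gt0; apply: contraNneq phi0 => ->; rewrite linear0.
  by rewrite pmulr_lge0.
have orth v : phi v = 0 -> dot l v = 0.
  move=> phiv; have nv : `|v| = (Re `|v|)%:C by rewrite RRe_real // normr_real.
  apply: (@norm_small (2 * Re `|v|)) => e e0.
  have e2 : 0 < Num.min e (e ^+ 2) by rewrite lt_min e0 exprn_gt0.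
  have [n []] := close _ e2.
  have -> : dot l v = dot (l - x n) v + dot (x n) v by rewrite dotBl subrK.
  have := lexx (Num.min e (e ^+ 2)); rewrite le_min => /andP[me me2].
  rewrite -lecR in me; move=> /le_trans/(_ me) ln /le_trans/(_ me2) ne.
  apply: le_trans (ler_normD _ _) _.
  have -> : (2 * Re `|v| * e)%:C = e%:C * `|v| + e%:C * `|v|.
    by rewrite nv -!rmorphM -rmorphD /=; congr _%:C; ring.
  apply: lerD.
    by apply: le_trans (dot_CS _ _) _; rewrite ler_wpM2r.
  rewrite -(@ler_pXn2r _ 2) ?nnegrE ?mulr_ge0 ?normr_ge0 ?lecR ?(ltW e0) //.
  have := @dot_min (x n) v m%:C; rewrite exprMn hdot_norm => /(_ _)/le_trans.
  apply=> [t|].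
    by rewrite dot_Re lecR mq // /A /= linearB linearZ /= phiv mulr0 subr0 xA.
  apply: (ler_wpM2r (dot_ge0 _)).
  rewrite dot_Re -rmorphB -rmorphXn lecR.
  by move: (xq n) ne; rewrite -/(q (x n)); move: (_^-1) => z; lra.
have l0 : dot l l != 0.
  rewrite dot_eq0; apply/eqP => l0; move: phil; rewrite l0 linear0 => /eqP.
  by rewrite eq_sym oner_eq0.
exists ((dot l l)^-1 *: l) => u.
have : dot l (u - phi u *: l) = 0.
  by rewrite orth // linearB linearZ /= phil mulr1 subrr.
rewrite dotZr geC0_conj ?invr_ge0 ?dot_ge0 // [dot l _]dotC => /(canRL conjCK).
rewrite conjC0 dotBl dotZl => /subr0_eq ->.
by rewrite mulrC mulfK.
Qed.
End HilbertTheory.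

(* The C*-algebra B(H) of bounded linear operators on H. *)
Record bop (R : realType) (H : hilbertType R) := Bop {
  bop_fun :> H -> H ;
  bop_linear : linear bop_fun ;
  bop_bounded : exists c : R, forall u, `|bop_fun u| <= c%:C * `|u| }.

Section Bop.
Variables (R : realType) (H : hilbertType R).
Implicit Types (X Y Z : bop H) (u v w : H) (c : R) (a : R[i]).
Local Notation dot := (@hdot R H).

HB.instance Definition _ := gen_eqMixin (bop H).
HB.instance Definition _ := gen_choiceMixin (bop H).
HB.instance Definition _ X :=
  GRing.isLinear.Build R[i] H H *:%R (bop_fun X) (bop_linear X).

Lemma bopP X Y : X =1 Y -> X = Y.
Proof.
case: X Y => [f fl fb] [g gl gb] /= /funext fg.
by subst g; congr Bop; exact: Prop_irrelevance.
Qed.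

Lemma normcE_re u : `|u| = (Re `|u|)%:C.
Proof. by rewrite RRe_real // normr_real. Qed.

Lemma realCM (a b : R) : (a * b)%:C = a%:C * b%:C :> R[i].
Proof. exact: rmorphM. Qed.

Lemma Re_normM (V : normedZmodType R[i]) (x : V) c :
  (Re `|x| * c)%:C = `|x| * c%:C.
Proof. by rewrite rmorphM; congr (_ * _); rewrite -[RHS]RRe_real ?normr_real. Qed.

Lemma Re_norm_ge0 (V : normedZmodType R[i]) (x : V) : 0 <= Re `|x|.
Proof. by rewrite -ler0c RRe_real ?normr_real. Qed.

Lemma Re_norm_gt0 (V : normedZmodType R[i]) (x : V) : (0 < Re `|x|) = (x != 0).
Proof. by rewrite -ltcR RRe_real ?normr_real // normr_gt0. Qed.

Lemma bop_bounded_ge0 (f : H -> H) : (exists c, forall u, `|f u| <= c%:C * `|u|) ->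
  exists2 c, 0 <= c & forall u, `|f u| <= c%:C * `|u|.
Proof.
move=> [c fc]; exists `|c| => // u; apply: le_trans (fc u) _.
by rewrite ler_wpM2r // lecR ler_norm.
Qed.

Fact bop_zero_linear : linear (fun _ : H => 0 : H).
Proof. by move=> a u v; rewrite scaler0 addr0. Qed.
Fact bop_zero_bounded : exists c, forall u, `|0 : H| <= c%:C * `|u|.
Proof. by exists 0 => u; rewrite normr0 mul0r. Qed.
Definition bop_zero := Bop bop_zero_linear bop_zero_bounded.

Fact bop_add_linear X Y : linear (fun u => X u + Y u).
Proof. by move=> a u v; rewrite !linearP scalerDr addrACA. Qed.
Fact bop_add_bounded X Y : exists c, forall u, `|X u + Y u| <= c%:C * `|u|.
Proof.
have [[c Xc] [d Yd]] := (bop_bounded X, bop_bounded Y).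
exists (c + d) => u; rewrite rmorphD mulrDl.
exact: le_trans (ler_normD _ _) (lerD (Xc u) (Yd u)).
Qed.
Definition bop_add X Y := Bop (bop_add_linear X Y) (bop_add_bounded X Y).

Fact bop_scale_linear a X : linear (fun u => a *: X u).
Proof. by move=> b u v; rewrite linearP scalerDr !scalerA mulrC. Qed.
Fact bop_scale_bounded a X : exists c, forall u, `|a *: X u| <= c%:C * `|u|.
Proof.
have [c Xc] := bop_bounded X; exists (Re `|a| * c) => u.
by rewrite normrZ Re_normM -mulrA ler_wpM2l.
Qed.
Definition bop_scale a X := Bop (bop_scale_linear a X) (bop_scale_bounded a X).

Fact bop_one_linear : linear (@id H). Proof. by []. Qed.
Fact bop_one_bounded : exists c, forall u, `|id u : H| <= c%:C * `|u|.
Proof. by exists 1 => u; rewrite mul1r. Qed.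
Definition bop_one := Bop bop_one_linear bop_one_bounded.

Fact bop_mul_linear X Y : linear (fun u => X (Y u)).
Proof. by move=> a u v; rewrite !linearP. Qed.
Fact bop_mul_bounded X Y : exists c, forall u, `|X (Y u)| <= c%:C * `|u|.
Proof.
have [[c c0 Xc] [d Yd]] := (bop_bounded_ge0 (bop_bounded X), bop_bounded Y).
exists (c * d) => u; rewrite rmorphM -mulrA; apply: le_trans (Xc _) _.
by rewrite ler_wpM2l // lecR.
Qed.
Definition bop_mul X Y := Bop (bop_mul_linear X Y) (bop_mul_bounded X Y).

Fact bop_addA : associative bop_add.
Proof. by move=> X Y Z; apply: bopP => u /=; rewrite addrA. Qed.
Fact bop_addC : commutative bop_add.
Proof. by move=> X Y; apply: bopP => u /=; rewrite addrC. Qed.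
Fact bop_add0 : left_id bop_zero bop_add.
Proof. by move=> X; apply: bopP => u /=; rewrite add0r. Qed.
Fact bop_addN : left_inverse bop_zero (bop_scale (-1)) bop_add.
Proof. by move=> X; apply: bopP => u /=; rewrite scaleN1r addNr. Qed.
HB.instance Definition _ :=
  GRing.isZmodule.Build (bop H) bop_addA bop_addC bop_add0 bop_addN.

Fact bop_mulA : associative bop_mul.
Proof. by move=> X Y Z; apply: bopP. Qed.
Fact bop_mul1l : left_id bop_one bop_mul.
Proof. by move=> X; apply: bopP. Qed.
Fact bop_mul1r : right_id bop_one bop_mul.
Proof. by move=> X; apply: bopP. Qed.
Fact bop_mulDl : left_distributive bop_mul bop_add.
Proof. by move=> X Y Z; apply: bopP. Qed.
Fact bop_mulDr : right_distributive bop_mul bop_add.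
Proof. by move=> X Y Z; apply: bopP => u /=; rewrite linearD. Qed.
Fact bop_one_neq0 : bop_one != 0 :> bop H.
Proof.
have [u u0] := @hilbert_neq0 R H; apply: contra_neq u0 => e.
by rewrite -[u]/(bop_one u) e.
Qed.
HB.instance Definition _ := GRing.Zmodule_isNzRing.Build (bop H)
  bop_mulA bop_mul1l bop_mul1r bop_mulDl bop_mulDr bop_one_neq0.

Fact bop_scaleA a b X : bop_scale a (bop_scale b X) = bop_scale (a * b) X.
Proof. by apply: bopP => u /=; rewrite scalerA. Qed.
Fact bop_scale1 : left_id 1 bop_scale.
Proof. by move=> X; apply: bopP => u /=; rewrite scale1r. Qed.
Fact bop_scaleDr : right_distributive bop_scale +%R.
Proof. by move=> a X Y; apply: bopP => u /=; rewrite scalerDr. Qed.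
Fact bop_scaleDl X a b : bop_scale (a + b) X = bop_scale a X + bop_scale b X.
Proof. by apply: bopP => u /=; rewrite scalerDl. Qed.
HB.instance Definition _ := GRing.Zmodule_isLmodule.Build R[i] (bop H)
  bop_scaleA bop_scale1 bop_scaleDr bop_scaleDl.

Fact bop_scaleAl a X Y : a *: (X * Y) = (a *: X) * Y.
Proof. exact: bopP. Qed.
HB.instance Definition _ :=
  GRing.Lmodule_isLalgebra.Build R[i] (bop H) bop_scaleAl.
Fact bop_scaleAr a X Y : a *: (X * Y) = X * (a *: Y).
Proof. by apply: bopP => u /=; rewrite linearZ. Qed.
HB.instance Definition _ :=
  GRing.Lalgebra_isAlgebra.Build R[i] (bop H) bop_scaleAr.

Lemma bopD X Y u : (X + Y) u = X u + Y u. Proof. by []. Qed.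
Lemma bopN X u : (- X) u = - X u. Proof. exact: scaleN1r. Qed.
Lemma bopB X Y u : (X - Y) u = X u - Y u. Proof. by rewrite bopD bopN. Qed.
Lemma bopM X Y u : (X * Y) u = X (Y u). Proof. by []. Qed.
Lemma bopZ a X u : (a *: X) u = a *: X u. Proof. by []. Qed.

Fact adjoint_exists X : exists Y : H -> H, forall u v, dot (X u) v = dot u (Y v).
Proof.
suff /choice[Y YP] : forall v, exists y, forall u, dot (X u) v = dot u y.
  by exists Y => u v; exact: YP.
move=> v; have [c Xc] := bop_bounded X.
have lin : scalar (fun u => dot (X u) v).
  by move=> a u w; rewrite linearP dotDl dotZl.
pose phi := GRing.isLinear.Build R[i] H R[i] *%R (fun u => dot (X u) v) lin.
pose f : {scalar H} := HB.pack (fun u => dot (X u) v) phi.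
apply: (@riesz _ _ f (Re `|v| * c)) => u /=.
apply: le_trans (dot_CS _ _) _.
by rewrite Re_normM [X in X <= _]mulrC -mulrA ler_wpM2l.
Qed.

Definition adjoint_fun X : H -> H := projT1 (cid (adjoint_exists X)).

Lemma adjoint_funE X u v : dot (X u) v = dot u (adjoint_fun X v).
Proof. by rewrite /adjoint_fun; case: cid. Qed.

Fact adjoint_linear X : linear (adjoint_fun X).
Proof.
move=> a u v; apply: dot_inj => w.
by rewrite dotDr dotZr -!adjoint_funE dotDr dotZr.
Qed.

Lemma adjoint_bound X c : (forall u, `|X u| <= c%:C * `|u|) ->
  forall u, `|adjoint_fun X u| <= c%:C * `|u|.
Proof.
move=> Xc u; have [->|Yu0] := eqVneq (adjoint_fun X u) 0.
  by rewrite normr0; exact: le_trans (Xc u).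
rewrite -(@ler_pM2l _ `|adjoint_fun X u|) ?normr_gt0 // -expr2 hdot_norm.
rewrite -adjoint_funE.
have /le_trans : dot (X (adjoint_fun X u)) u <= `|dot (X (adjoint_fun X u)) u|.
  by rewrite adjoint_funE -hdot_norm real_ler_norm // rpredX // normr_real.
apply; apply: le_trans (dot_CS _ _) _.
by rewrite mulrCA mulrA ler_wpM2r // [X in _ <= X]mulrC.
Qed.

Fact adjoint_bounded X :
  exists c, forall u, `|adjoint_fun X u| <= c%:C * `|u|.
Proof. by have [c Xc] := bop_bounded X; exists c; exact: adjoint_bound. Qed.

Definition adjoint X := Bop (adjoint_linear X) (adjoint_bounded X).

Lemma adjointE X u v : dot (X u) v = dot u (adjoint X v).
Proof. exact: adjoint_funE. Qed.

Fact adjointK : involutive adjoint.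
Proof.
move=> X; apply: bopP => u; apply: dot_inj => w.
by rewrite -adjointE dotC -adjointE -dotC.
Qed.
Fact adjointD X Y : adjoint (X + Y) = adjoint X + adjoint Y.
Proof.
apply: bopP => u; apply: dot_inj => w.
by rewrite -adjointE !bopD dotDr dotDl !adjointE.
Qed.
Fact adjointZ a X : adjoint (a *: X) = a^*%R *: adjoint X.
Proof.
apply: bopP => u; apply: dot_inj => w.
by rewrite -adjointE !bopZ dotZr dotZl conjCK !adjointE.
Qed.
Fact adjointM X Y : adjoint (X * Y) = adjoint Y * adjoint X.
Proof.
apply: bopP => u; apply: dot_inj => w.
by rewrite -adjointE !bopM !adjointE.
Qed.
HB.instance Definition _ := isStarAlgebra.Build R (bop H)
  adjointK adjointD adjointZ adjointM.

Definition opnorm X : R :=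
  inf [set c | 0 <= c /\ forall u, `|X u| <= c%:C * `|u|].

Lemma opnorm_has_inf X :
  has_inf [set c | 0 <= c /\ forall u, `|X u| <= c%:C * `|u|].
Proof.
have [c c0 Xc] := bop_bounded_ge0 (bop_bounded X).
by split; [exists c|exists 0 => d []].
Qed.

Lemma opnorm_ge0 X : 0 <= opnorm X.
Proof. by apply: lb_le_inf => [|c []//]; case: (opnorm_has_inf X). Qed.

Lemma opnorm_le X c : 0 <= c -> (forall u, `|X u| <= c%:C * `|u|) ->
  opnorm X <= c.
Proof. by move=> c0 Xc; apply: ge_inf; [case: (opnorm_has_inf X)|]. Qed.

Lemma opnorm_ub X u : `|X u| <= (opnorm X)%:C * `|u|.
Proof.
rewrite (normcE_re (X u)) (normcE_re u) -realCM lecR.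
have [->|u0] := eqVneq u 0; first by rewrite linear0 !normr0 mulr0.
have pu : 0 < Re `|u| by rewrite Re_norm_gt0.
rewrite -ler_pdivrMr //; apply: lb_le_inf => [|c [c0 Xc]].
  by case: (opnorm_has_inf X).
by rewrite ler_pdivrMr // -lecR realCM -!normcE_re.
Qed.

Fact opnormD X Y : opnorm (X + Y) <= opnorm X + opnorm Y.
Proof.
apply: opnorm_le => [|u]; first by rewrite addr_ge0 ?opnorm_ge0.
rewrite rmorphD mulrDl; apply: le_trans (ler_normD _ _) _.
by rewrite lerD ?opnorm_ub.
Qed.

Fact opnorm_eq0 X : opnorm X = 0 -> X = 0.
Proof.
move=> X0; apply: bopP => u; apply/eqP; rewrite -normr_le0.
by apply: le_trans (opnorm_ub X u) _; rewrite X0 mul0r.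
Qed.

Lemma opnormZ_le a X : opnorm (a *: X) <= Re `|a| * opnorm X.
Proof.
apply: opnorm_le => [|u].
  by rewrite mulr_ge0 ?opnorm_ge0 ?Re_norm_ge0.
by rewrite Re_normM -mulrA bopZ normrZ ler_wpM2l // opnorm_ub.
Qed.

Fact opnormZ a X : (opnorm (a *: X))%:C = `|a| * (opnorm X)%:C.
Proof.
rewrite -Re_normM; congr (_%:C); apply/eqP; rewrite eq_le opnormZ_le andTb.
have [->|a0] := eqVneq a 0.
  by rewrite normr0 mul0r opnorm_ge0.
have pa : 0 < Re `|a| by rewrite Re_norm_gt0.
have := opnormZ_le a^-1 (a *: X); rewrite scalerA mulVf // scale1r.
have -> : Re `|a^-1| = (Re `|a|)^-1.
  apply: complexI; rewrite fmorphV RRe_real ?normr_real //.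
  by rewrite normfV; congr (_^-1); rewrite -[LHS]RRe_real ?normr_real.
by rewrite ler_pdivlMl.
Qed.

Fact opnormM X Y : opnorm (X * Y) <= opnorm X * opnorm Y.
Proof.
apply: opnorm_le => [|u]; first by rewrite mulr_ge0 ?opnorm_ge0.
rewrite bopM rmorphM -mulrA; apply: le_trans (opnorm_ub _ _) _.
by rewrite ler_wpM2l ?lecR ?opnorm_ge0 ?opnorm_ub.
Qed.

Lemma opnorm_adjoint X : opnorm (adjoint X) <= opnorm X.
Proof.
apply: opnorm_le (opnorm_ge0 _) _ => u; apply: adjoint_bound => {}u.
exact: opnorm_ub.
Qed.

Fact opnorm_star X : opnorm (star X * X) = opnorm X ^+ 2.
Proof.
apply/eqP; rewrite eq_le; apply/andP; split.
  apply: le_trans (opnormM _ _) _.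
  by rewrite expr2 ler_wpM2r ?opnorm_ge0 // opnorm_adjoint.
rewrite -ler_sqrt ?opnorm_ge0 // sqrtr_sqr ger0_norm ?opnorm_ge0 //.
apply: opnorm_le => [|u]; first exact: sqrtr_ge0.
rewrite -(@ler_pXn2r _ 2) ?nnegrE ?mulr_ge0 ?lecR ?sqrtr_ge0 //.
rewrite exprMn -rmorphXn sqr_sqrtr ?opnorm_ge0 // hdot_norm.
rewrite adjointE; set w := adjoint X (X u).
have -> : w = (star X * X) u by [].
have /le_trans : dot u ((star X * X) u) <= `|dot u ((star X * X) u)|.
  by rewrite -adjointE -hdot_norm real_ler_norm // rpredX // normr_real.
apply; apply: le_trans (dot_CS _ _) _.
by rewrite mulrC expr2 mulrA ler_wpM2r // opnorm_ub.
Qed.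

Fact opnorm_complete (X : nat -> bop H) :
  (forall e : R, 0 < e -> exists N, forall m n, (N <= m)%N -> (N <= n)%N ->
     opnorm (X m - X n) < e) ->
  exists L, (opnorm (X n - L)) @[n --> \oo] --> (0 : R).
Proof.
move=> cX.
have cXu u : cvg ((fun n => X n u) @ \oo).
  apply: cauchy_cvg; apply: cauchy_exP => e e0.
  have eE : e = (Re e)%:C by rewrite RRe_real // gtr0_real.
  have re0 : 0 < Re e by rewrite -ltcR -eE.
  have k0 : 0 < Re `|u| + 1.
    by rewrite ltr_wpDl // Re_norm_ge0.
  have [N NP] := cX _ (divr_gt0 re0 k0).
  exists (X N u); exists N => // n /= Nn.
  rewrite -ball_normE /ball_ /= -bopB; apply: le_lt_trans (opnorm_ub _ _) _.
  rewrite normcE_re eE -realCM ltcR.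
  have /ltW h := NP N n (leqnn N) Nn.
  apply: (@le_lt_trans _ _ (Re e / (Re `|u| + 1) * Re `|u|)).
    by rewrite ler_wpM2r // Re_norm_ge0.
  by rewrite mulrAC ltr_pdivrMr // ltr_pM2l // ltrDl.
pose L u := lim ((fun n => X n u) @ \oo).
have Lcvg u : (fun n => X n u) @ \oo --> L u by exact: cXu.
have Llin : linear L.
  move=> a u v; apply/cvg_lim => //.
  under eq_fun do rewrite linearP.
  exact: (cvgD (cvgZ (cvg_cst a) (Lcvg u)) (Lcvg v)).
have near_L (e : R) : 0 < e -> exists N, forall n, (N <= n)%N ->
    forall u, `|X n u - L u| <= e%:C * `|u|.
  move=> e0; have [N NP] := cX _ e0; exists N => n Nn u.
  have er : e%:C * `|u| \is Num.real by rewrite normcE_re -realCM complex_real.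
  rewrite real_leNgt // ?normr_real //; apply/negP => gt.
  have dcvg : (fun m => X n u - X m u) @ \oo --> X n u - L u.
    by apply: cvgB => //; exact: cvg_cst.
  have [M _ MP] := cvgr_norm_gt _ dcvg _ gt.
  have := MP (maxn M N); rewrite /= leq_maxl => /(_ isT).
  rewrite real_ltNge // ?normr_real //; move=> /negP; apply.
  rewrite -bopB; apply: le_trans (opnorm_ub _ _) _.
  by rewrite ler_wpM2r // lecR ltW // NP // leq_maxr.
have Lbnd : exists c, forall u, `|L u| <= c%:C * `|u|.
  have [N NP] := near_L 1 ltr01; have [c Xc] := bop_bounded (X N).
  exists (c + 1) => u; rewrite rmorphD mulrDl.
  have -> : L u = X N u - (X N u - L u) by rewrite subKr.
  exact: le_trans (ler_normB _ _) (lerD (Xc u) (NP _ (leqnn N) u)).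
exists (Bop Llin Lbnd); apply/cvgrPdist_le => e e0.
have [N NP] := near_L _ e0; exists N => // n /= Nn.
rewrite sub0r normrN ger0_norm ?opnorm_ge0 // opnorm_le ?ltW // => u.
by rewrite bopB; exact: NP.
Qed.

HB.instance Definition _ := isCStarAlgebra.Build R (bop H)
  opnormD opnormZ opnorm_eq0 opnormM opnorm_star opnorm_complete.
End Bop.

Section CStarGenerated.
Variables (R : realType) (A : cstarAlgType R).

(* Norm-closed unital *-subalgebras. *)
Definition cstar_subalgebra (D : set A) :=
  [/\ D 1,
      forall (a : R[i]) x y, D x -> D y -> D (a *: x + y),
      forall x y, D x -> D y -> D (x * y),
      forall x, D x -> D (star x) &
      forall x, (forall e : R, 0 < e -> exists2 y, D y & cnorm (x - y) < e) ->
        D x].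

Variables (I : Type) (T : I -> A).

Definition cstar_gen : set A := smallest cstar_subalgebra (range T).

Lemma cstar_genP : cstar_subalgebra cstar_gen.
Proof.
split=> [D [[]]//|a x y Dx Dy D DP|x y Dx Dy D DP|x Dx D DP|x Dx D DP].
- by have [[_ + _ _ _] _] := DP; apply; [exact: Dx|exact: Dy].
- by have [[_ _ + _ _] _] := DP; apply; [exact: Dx|exact: Dy].
- by have [[_ _ _ + _] _] := DP; apply; exact: Dx.
- have [[_ _ _ _ +] _] := DP; apply => e /Dx[y Dy xy].
  by exists y => //; exact: Dy.
Qed.

Definition cstar_gen_pred : {pred A} := [pred x | `[< cstar_gen x >]].

(* The unital C*-algebra generated by a family T, as a cstarAlgType. *)
Record cstar_gen_type := CStarGen {
  cstar_gen_val :> A ;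
  cstar_gen_valP : cstar_gen_val \in cstar_gen_pred }.

Fact cstar_gen_subalg : subalg_closed cstar_gen_pred.
Proof.
have [D1 DL DM _ _] := cstar_genP.
have genE x : (x \in cstar_gen_pred) = `[< cstar_gen x >] by [].
split=> [|a x y|x y]; rewrite !genE; first exact/asboolP.
  by move=> /asboolP Dx /asboolP Dy; apply/asboolP; exact: DL.
by move=> /asboolP Dx /asboolP Dy; apply/asboolP; exact: DM.
Qed.
HB.instance Definition _ :=
  GRing.isSubalgClosed.Build R[i] A cstar_gen_pred cstar_gen_subalg.
HB.instance Definition _ := [isSub for cstar_gen_val].
HB.instance Definition _ := [Choice of cstar_gen_type by <:].
HB.instance Definition _ := [SubChoice_isSubAlgebra of cstar_gen_type by <:].

Implicit Types x y : cstar_gen_type.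

Fact cstar_gen_star_subproof x :
  star (cstar_gen_val x) \in cstar_gen_pred.
Proof.
have [_ _ _ DS _] := cstar_genP.
by case: x => x /= /asboolP Dx; apply/asboolP; exact: DS.
Qed.
Definition cstar_gen_star x := CStarGen (cstar_gen_star_subproof x).

Fact cstar_gen_starK : involutive cstar_gen_star.
Proof. by move=> x; apply: val_inj; rewrite /= starK. Qed.
Fact cstar_gen_starD x y :
  cstar_gen_star (x + y) = cstar_gen_star x + cstar_gen_star y.
Proof. by apply: val_inj; rewrite /= starD. Qed.
Fact cstar_gen_starZ (a : R[i]) x :
  cstar_gen_star (a *: x) = a^*%R *: cstar_gen_star x.
Proof. by apply: val_inj; rewrite /= starZ. Qed.
Fact cstar_gen_starM x y :
  cstar_gen_star (x * y) = cstar_gen_star y * cstar_gen_star x.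
Proof. by apply: val_inj; rewrite /= starM. Qed.
HB.instance Definition _ := isStarAlgebra.Build R cstar_gen_type
  cstar_gen_starK cstar_gen_starD cstar_gen_starZ cstar_gen_starM.

Definition cstar_gen_norm x : R := cnorm (cstar_gen_val x).

Fact cstar_gen_normD x y :
  cstar_gen_norm (x + y) <= cstar_gen_norm x + cstar_gen_norm y.
Proof. exact: cnormD. Qed.
Fact cstar_gen_normZ (a : R[i]) x :
  (cstar_gen_norm (a *: x))%:C = `|a| * (cstar_gen_norm x)%:C.
Proof. exact: cnormZ. Qed.
Fact cstar_gen_norm_eq0 x : cstar_gen_norm x = 0 -> x = 0.
Proof. by move=> /cnorm_eq0 x0; apply: val_inj. Qed.
Fact cstar_gen_normM x y :
  cstar_gen_norm (x * y) <= cstar_gen_norm x * cstar_gen_norm y.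
Proof. exact: cnormM. Qed.
Fact cstar_gen_norm_star x :
  cstar_gen_norm (star x * x) = cstar_gen_norm x ^+ 2.
Proof. exact: cnorm_star. Qed.
Fact cstar_gen_norm_complete (x : nat -> cstar_gen_type) :
  (forall e : R, 0 < e -> exists N, forall m n, (N <= m)%N -> (N <= n)%N ->
     cstar_gen_norm (x m - x n) < e) ->
  exists l, (cstar_gen_norm (x n - l)) @[n --> \oo] --> (0 : R).
Proof.
move=> /(@cnorm_complete R A (fun n => x n))[l xl].
suff Dl : l \in cstar_gen_pred by exists (CStarGen Dl).
have [_ _ _ _ DC] := cstar_genP; apply/asboolP; apply: DC => e e0.
have /cvgrPdist_lt/(_ e e0)[N _ NP] := xl.
exists (cstar_gen_val (x N)); first exact/asboolP/cstar_gen_valP.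
have := NP N (leqnn N); rewrite sub0r normrN => /(le_lt_trans (ler_norm _)).
suff -> : cnorm (l - cstar_gen_val (x N)) = cnorm (cstar_gen_val (x N) - l) by [].
by apply: complexI; rewrite -opprB -scaleN1r cnormZ normrN1 mul1r.
Qed.
HB.instance Definition _ := isCStarAlgebra.Build R cstar_gen_type
  cstar_gen_normD cstar_gen_normZ cstar_gen_norm_eq0 cstar_gen_normM
  cstar_gen_norm_star cstar_gen_norm_complete.

Fact cstar_gen_elt_subproof (i : I) : T i \in cstar_gen_pred.
Proof. by apply/asboolP => D [_]; apply; exists i. Qed.
Definition cstar_gen_elt (i : I) : cstar_gen_type :=
  CStarGen (cstar_gen_elt_subproof i).

End CStarGenerated.

(* The unital *-algebra C(X). Its norm is not needed: on a C*-algebra, the notion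
   of positive linear functional involves the *-algebra structure only. *)
Section ContinuousFunctions.
Variables (R : realType) (X : ptopologicalType).
Local Notation CX := (continuousType X R[i]).
Implicit Types f g h : CX.

Definition cf_zero : CX := cst 0.
Definition cf_one : CX := cst 1.
Definition cf_add f g : CX :=
  mkcts (fun x => continuousD (@cts_fun _ _ f x) (@cts_fun _ _ g x)).
Definition cf_opp f : CX := mkcts (fun x => continuousN (@cts_fun _ _ f x)).
Definition cf_mul f g : CX :=
  mkcts (fun x => continuousM (@cts_fun _ _ f x) (@cts_fun _ _ g x)).
Definition cf_scale (a : R[i]) f : CX := cf_mul (cst a : CX) f.

Fact cf_conj_continuous f : continuous (fun x => (f x)^*%R).
Proof.
move=> x; apply/cvgrPdist_lt => e e0.
have /cvgrPdist_lt/(_ e e0) := @cts_fun _ _ f x.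
by apply: filterS => y; rewrite -rmorphB /= norm_conjC.
Qed.
Definition cf_conj f : CX := mkcts (@cf_conj_continuous f).

Lemma cfP f g : f =1 g -> f = g. Proof. by move/continuousEP. Qed.

Fact cf_addA : associative cf_add.
Proof. by move=> f g h; apply: cfP => x /=; rewrite /mkcts/= addrA. Qed.
Fact cf_addC : commutative cf_add.
Proof. by move=> f g; apply: cfP => x; exact: addrC. Qed.
Fact cf_add0 : left_id cf_zero cf_add.
Proof. by move=> f; apply: cfP => x; exact: add0r. Qed.
Fact cf_addN : left_inverse cf_zero cf_opp cf_add.
Proof. by move=> f; apply: cfP => x; exact: addNr. Qed.
HB.instance Definition _ :=
  GRing.isZmodule.Build CX cf_addA cf_addC cf_add0 cf_addN.

Fact cf_mulA : associative cf_mul.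
Proof. by move=> f g h; apply: cfP => x; exact: mulrA. Qed.
Fact cf_mul1l : left_id cf_one cf_mul.
Proof. by move=> f; apply: cfP => x; exact: mul1r. Qed.
Fact cf_mul1r : right_id cf_one cf_mul.
Proof. by move=> f; apply: cfP => x; exact: mulr1. Qed.
Fact cf_mulDl : left_distributive cf_mul cf_add.
Proof. by move=> f g h; apply: cfP => x; exact: mulrDl. Qed.
Fact cf_mulDr : right_distributive cf_mul cf_add.
Proof. by move=> f g h; apply: cfP => x; exact: mulrDr. Qed.
Fact cf_one_neq0 : cf_one != 0 :> CX.
Proof.
by apply/eqP => /continuousEP/(_ point)/eqP; apply/negP; exact: oner_neq0.
Qed.
HB.instance Definition _ := GRing.Zmodule_isNzRing.Build CX
  cf_mulA cf_mul1l cf_mul1r cf_mulDl cf_mulDr cf_one_neq0.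

Fact cf_scaleA a b f : cf_scale a (cf_scale b f) = cf_scale (a * b) f.
Proof. by apply: cfP => x; exact: mulrA. Qed.
Fact cf_scale1 : left_id 1 cf_scale.
Proof. by move=> f; apply: cfP => x; exact: mul1r. Qed.
Fact cf_scaleDr : right_distributive cf_scale +%R.
Proof. by move=> a f g; apply: cfP => x; exact: mulrDr. Qed.
Fact cf_scaleDl f a b : cf_scale (a + b) f = cf_scale a f + cf_scale b f.
Proof. by apply: cfP => x; exact: mulrDl. Qed.
HB.instance Definition _ := GRing.Zmodule_isLmodule.Build R[i] CX
  cf_scaleA cf_scale1 cf_scaleDr cf_scaleDl.
Fact cf_scaleAl a f g : a *: (f * g) = (a *: f) * g.
Proof. by apply: cfP => x; exact: mulrA. Qed.
HB.instance Definition _ := GRing.Lmodule_isLalgebra.Build R[i] CX cf_scaleAl.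
Fact cf_scaleAr a f g : a *: (f * g) = f * (a *: g).
Proof. by apply: cfP => x; exact: mulrCA. Qed.
HB.instance Definition _ := GRing.Lalgebra_isAlgebra.Build R[i] CX cf_scaleAr.

Fact cf_conjK : involutive cf_conj.
Proof. by move=> f; apply: cfP => x; exact: conjCK. Qed.
Fact cf_conjD f g : cf_conj (f + g) = cf_conj f + cf_conj g.
Proof. by apply: cfP => x; exact: rmorphD. Qed.
Fact cf_conjZ a f : cf_conj (a *: f) = a^*%R *: cf_conj f.
Proof. by apply: cfP => x; exact: rmorphM. Qed.
Fact cf_conjM f g : cf_conj (f * g) = cf_conj g * cf_conj f.
Proof.
by apply: cfP => x; apply: etrans (mulrC _ _); exact: rmorphM.
Qed.
HB.instance Definition _ := isStarAlgebra.Build R CX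
  cf_conjK cf_conjD cf_conjZ cf_conjM.

End ContinuousFunctions.

(* Functions on the ball are represented by functions on the whole space whose
   values outside of the ball are irrelevant. Note that the norm of the library
   on 'rV is the sup norm, hence the explicit Euclidean norms. *)
Section Ball.
Variables (R : realType) (d : nat).
Local Notation C := R[i].

Definition uball : set 'rV[C]_d := [set z | \sum_j `|z 0 j| ^+ 2 < 1].

Definition usphere : set 'rV[C]_d := [set z | \sum_j `|z 0 j| ^+ 2 = 1].

Definition holomorphic : set ('rV[C]_d -> C) :=
  [set f | forall z, uball z -> differentiable f z].

Definition dilation (r : R) (f : 'rV[C]_d -> C) : 'rV[C]_d -> C :=
  fun z => f (r%:C *: z).

(* {family compactly_in uball, _ -> _} carries the topology of uniform
   convergence on compact subsets of the ball; pclass_closed is closedness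
   relatively to the space of holomorphic functions. Since that topology does not
   see the values outside of the ball, pclass_closed forces membership in P to be
   independent of these values. *)
Record positive_class (P : set ('rV[C]_d -> C)) : Prop := {
  pclass_holo : P `<=` holomorphic ;
  pclass_Re : forall f, P f -> forall z, uball z -> 0 <= Re (f z) ;
  pclass_nonempty : P !=set0 ;
  pclass_cone : forall (s t : R) f g, 0 <= s -> 0 <= t -> P f -> P g ->
    P (fun z => s%:C * f z + t%:C * g z) ;
  pclass_closed : forall f, holomorphic f ->
    closure (P : set {family compactly_in uball, 'rV[C]_d -> C}) f -> P f ;
  pclass_dilation : forall (r : R) f, 0 <= r <= 1 -> P f -> P (dilation r f) }.

(* The two-sided inverse of a if there is one, and 0 otherwise. *)
Definition ring_inv (A : nzRingType) (a : A) : A :=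
  xget 0 [set b | a * b = 1 /\ b * a = 1].

Definition Hkernel (A : starAlgType R) (z : 'rV[C]_d) (T : 'I_d -> A) : A :=
  2 *: ring_inv (1 - \sum_j z 0 j *: T j) - 1.

Definition positive_functional (A : starAlgType R) (rho : {scalar A}) :=
  forall a : A, 0 <= rho (star a * a).

(* The term 'i * Im (f 0) stands for an arbitrary imaginary constant: evaluation at
   0 gives f 0 = rho 1 + 'i * Im (f 0), and rho 1 is real. *)
Definition herglotz_class (A : starAlgType R) (T : 'I_d -> A) :
    set ('rV[C]_d -> C) :=
  [set f | exists2 rho : {scalar A}, positive_functional rho &
     forall z, uball z -> f z = rho (Hkernel z T) + 'i * (Im (f 0))%:C].

End Ball.
Arguments uball : clear implicits.
Arguments usphere : clear implicits.

Definition sphere_type (R : realType) (n : nat) : Type := usphere R n.+1.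
HB.instance Definition _ (R : realType) (n : nat) :=
  Topological.copy (sphere_type R n) (usphere R n.+1 : Type).

Fact sphere_point_subproof (R : realType) (n : nat) :
  (delta_mx 0 0 : 'rV[R[i]]_n.+1) \in usphere R n.+1.
Proof.
rewrite inE /usphere /= (bigD1 ord0) //= big1 => [|j j0].
  by rewrite mxE !eqxx normr1 expr1n addr0.
by rewrite mxE (negbTE j0) andbF normr0 expr0n.
Qed.
HB.instance Definition _ (R : realType) (n : nat) :=
  isPointed.Build (sphere_type R n)
    (exist (fun z => z \in usphere R n.+1) _ (sphere_point_subproof R n)).

Fact sphere_coord_continuous (R : realType) (n : nat) (j : 'I_n.+1) :
  continuous (fun z : sphere_type R n => \val z 0 j : R[i]).
Proof.
move=> z; apply: (@continuous_comp _ _ _ (fun w : sphere_type R n => \val w)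
  (fun M : 'rV[R[i]]_n.+1 => M 0 j)); last exact: coord_continuous.
exact: initial_continuous.
Qed.
Definition sphere_coord (R : realType) (n : nat) (j : 'I_n.+1) :
    continuousType (sphere_type R n) R[i] :=
  mkcts (@sphere_coord_continuous R n j).

Section DruryArveson.
Variables (R : realType) (d : nat).
Local Notation C := R[i].

(* H is, via ev, a Hilbert space of functions on D with reproducing kernel K;
   ev u is only meaningful on D. Such an H is unique up to a unitary
   isomorphism compatible with ev. *)
Record is_rkhs (X : Type) (D : set X) (K : X -> X -> C) (H : hilbertType R)
    (ev : H -> X -> C) : Prop := {
  rkhs_linear : forall (a : C) u v x, D x ->
    ev (a *: u + v) x = a * ev u x + ev v x ;
  rkhs_inj : forall u, (forall x, D x -> ev u x = 0) -> u = 0 ;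
  rkhs_kernel : forall y, D y -> exists k : H,
    (forall x, D x -> ev k x = K x y) /\ (forall u, ev u y = hdot u k) }.

Definition drury_arveson_kernel (z w : 'rV[C]_d) : C :=
  (1 - \sum_j z 0 j * (w 0 j)^*%R)^-1.

Definition drury_arveson (H : hilbertType R) (ev : H -> 'rV[C]_d -> C) :=
  is_rkhs (uball R d) drury_arveson_kernel ev.

Definition coordinate_shift (H : hilbertType R) (ev : H -> 'rV[C]_d -> C)
    (S : 'I_d -> bop H) :=
  forall j u z, uball R d z -> ev (S j u) z = z 0 j * ev u z.
End DruryArveson.

Section Cuntz.
Variables (R : realType) (d : nat).

Definition cuntz_relations (A : cstarAlgType R) (V : 'I_d -> A) :=
  (forall i j, star (V i) * V j = (i == j)%:R) /\
  \sum_j V j * star (V j) = 1.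

(* A is generated by V as a C*-algebra and is universal for the relations; the
   morphism phi is unique because V generates A. *)
Definition cuntz_algebra (A : cstarAlgType R) (V : 'I_d -> A) :=
  [/\ cuntz_relations V,
      cstar_gen V = setT &
      forall (B : cstarAlgType R) (W : 'I_d -> B), cuntz_relations W ->
        exists2 phi : {lrmorphism A -> B},
          forall a, phi (star a) = star (phi a) & forall j, phi (V j) = W j].
End Cuntz.

(* Main.v *)
Require Import Defs.
From HB Require Import structures.
From mathcomp Require Import all_boot all_order all_algebra.
From mathcomp Require Import complex separable cyclic cyclotomic.
From mathcomp Require Import all_classical all_reals topology normedtype.
From mathcomp Require Import derive realfun landau sequences.
From mathcomp Require Import ring lra.
Set Implicit Arguments.
Unset Strict Implicit.
Unset Printing Implicit Defensive.
Import Order.TTheory GRing.Theory Num.Theory.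
Import numFieldNormedType.Exports.
Local Open Scope classical_set_scope.
Local Open Scope ring_scope.
Local Open Scope complex_scope.

Local Notation Re := complex.Re.
Local Notation Im := complex.Im.

(* A positive functional rho on a unital C*-algebra is bounded, because 1 - h has a
   selfadjoint square root when h is selfadjoint and |h| < 1. For |x| < 1 and
   Q = (1 - x)^-1, the real part of 2 Q - 1 is Q (1 - x x^* ) Q^*, so the functions
   rho (H (z, T)) have nonnegative real part, and the resolvent identity makes them
   holomorphic. Since |rho| is controlled by f 0, a pointwise limit of such functions
   is again of this form: take the limit of the functionals along an ultrafilter.
   Dilations reduce to rotations: f (r z) is the limit of the combinations
   \sum_k w_k f (o_k z), where the o_k are roots of unity and the w_k >= 0 discretize
   the Poisson kernel. Rotations come from *-endomorphisms mapping T_j to a T_j with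
   |a| = 1: composition with the rotation of the sphere, conjugation by the unitary
   u |-> u (a z) of the Drury-Arveson space, and universality of the Cuntz algebra. *)

(** The obvious functional for f (r z) would be rho composed with a *-endomorphism T_j |-> r T_j,
    but there is none for 0 < r < 1: in all three cases sum_j T_j T_j^* is a nonzero projection, and
    its image would be r^2 times itself. Averages of rotations replace the missing map. Since the
    class is closed under pointwise limits, finite averages suffice and no integral over the circle
    is formed. They converge because a |-> f (a z) expands in powers of a whose coefficients decay
    like N(z.T)^j, so that only finitely many moments of the weights matter. What has to be known
    about T is therefore a norm as in [cstar_norm], the strict bound N(z.T) < 1 on the ball, and the
    gauge maps T_j |-> a T_j. In the closure argument an ultrafilter is used because it provides
    limits on all elements of the algebra at once, where a subsequence would require
    separability. *)

#[local] Instance fmap_ultra (T U : Type) (G : set_system T) (f : T -> U) :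
  UltraFilter G -> UltraFilter (f @ G).
Proof.
move=> UG; apply: Build_UltraFilter => H PH GH; apply/seteqP; split=> // A HA.
have [//|GA] := in_ultra_setVsetC (f @^-1` A) UG.
have /filter_ex[x []] : H (A `&` ~` A) by apply: filterI => //; exact: GH.
by [].
Qed.

Lemma invS_small (R : realType) (t : R) :
  0 < t -> exists N : nat, forall n, (N <= n)%N -> n.+1%:R^-1 < t.
Proof.
move=> t0; exists (Num.truncn t^-1) => n Nn; rewrite invf_plt ?posrE //.
by rewrite (lt_le_trans (truncnS_gt _)) // ler_nat.
Qed.

(** * Real-valued norms and limits in [R[i]] *)

Section RealValuedNorm.
Variables (R : realType) (V : normedZmodType R[i]).
Implicit Types u v : V.

(** Complex norms live in [R[i]], whose order is partial; the real value makes [lra], [nra], suprema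
    and real limits available. *)
Definition rnorm u : R := Re `|u|.

Lemma rnormE u : `|u| = (rnorm u)%:C.
Proof. by rewrite /rnorm RRe_real ?normr_real. Qed.

Lemma rnorm_ge0 u : 0 <= rnorm u.
Proof. by rewrite -ler0c -rnormE. Qed.

Lemma rnormD u v : rnorm (u + v) <= rnorm u + rnorm v.
Proof. by rewrite -lecR rmorphD /= -!rnormE ler_normD. Qed.

Lemma rnormB u v : rnorm (u - v) <= rnorm u + rnorm v.
Proof. by rewrite -lecR rmorphD /= -!rnormE ler_normB. Qed.

Lemma rnormN u : rnorm (- u) = rnorm u.
Proof. by rewrite /rnorm normrN. Qed.

Lemma rnormC u v : rnorm (u - v) = rnorm (v - u).
Proof. by rewrite -rnormN opprB. Qed.

Lemma rnorm0 : rnorm (0 : V) = 0.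
Proof. by rewrite /rnorm normr0. Qed.

Lemma rnorm0_eq0 u : rnorm u = 0 -> u = 0.
Proof. by move=> u0; apply/eqP; rewrite -normr_eq0 rnormE u0. Qed.

Lemma rnorm_sum I (r : seq I) (P : pred I) (F : I -> V) :
  rnorm (\sum_(i <- r | P i) F i) <= \sum_(i <- r | P i) rnorm (F i).
Proof. by rewrite -lecR -rnormE rmorph_sum /= (le_trans (ler_norm_sum _ _ _))
  // ler_sum // => i _; rewrite rnormE. Qed.

End RealValuedNorm.

Section ComplexNorm.
Variable R : realType.
Local Notation C := R[i].
Implicit Types a b : C.

Lemma rnorm1 : rnorm (1 : C) = 1.
Proof. by rewrite /rnorm normr1. Qed.

Lemma rnormM a b : rnorm (a * b) = rnorm a * rnorm b.
Proof. by apply: complexI; rewrite rmorphM /= -!rnormE normrM. Qed.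

Lemma rnormX a n : rnorm (a ^+ n) = rnorm a ^+ n.
Proof. by apply: complexI; rewrite rmorphXn /= -!rnormE normrX. Qed.

Lemma rnormV a : rnorm a^-1 = (rnorm a)^-1.
Proof. by apply: complexI; rewrite fmorphV /= -!rnormE normfV. Qed.

Lemma rnorm_real (x : R) : rnorm (x%:C : C) = `|x|.
Proof. by apply: complexI;
  rewrite -rnormE normc_def /= expr0n addr0 sqrtr_sqr. Qed.

Lemma rnorm_conj a : rnorm a^*%R = rnorm a.
Proof. by rewrite /rnorm norm_conjC. Qed.

Lemma rnormZ (V : normedModType C) a (v : V) : rnorm (a *: v) =
  rnorm a * rnorm v.
Proof. by apply: complexI; rewrite rmorphM /= -!rnormE normrZ. Qed.

Lemma normr_Re_le a : `|Re a| <= rnorm a.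
Proof.
rewrite -lecR -rnormE; case: a => x y; rewrite normc_def /= lecR.
by rewrite -(sqrtr_sqr x) ler_sqrt ?addr_ge0 ?sqr_ge0 // lerDl sqr_ge0.
Qed.

Lemma normr_Im_le a : `|Im a| <= rnorm a.
Proof.
rewrite -lecR -rnormE; case: a => x y; rewrite normc_def /= lecR.
by rewrite -(sqrtr_sqr y) ler_sqrt ?addr_ge0 ?sqr_ge0 // lerDr sqr_ge0.
Qed.

Lemma cvg_rnormP (V : normedModType C) T (F : set_system T) {FF : Filter F}
    (g : T -> V) (l : V) :
  (forall e : R, 0 < e -> \forall x \near F, rnorm (l - g x) < e) <-> g @ F
    --> l.
Proof.
split=> [H|/cvgrPdist_lt H e e0]; last first.
  have := H e%:C; rewrite ltcR => /(_ e0); apply: filterS => x.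
  by rewrite rnormE ltcR.
apply/cvgrPdist_lt => e e0.
have eE : e = (Re e)%:C by rewrite RRe_real // gtr0_real.
have := H (Re e); rewrite -ltcR -eE => /(_ e0); apply: filterS => x.
by rewrite rnormE -ltcR -eE.
Qed.

Lemma real_complex_continuous : continuous (fun x : R => x%:C : C).
Proof.
move=> x; apply/cvg_rnormP => e e0; near=> y.
rewrite -rmorphB /= rnorm_real; near: y.
exact: (@cvgr_dist_lt _ _ _ (nbhs x) _ id x).
Unshelve. all: by end_near. Qed.

Lemma rnorm_contraction_continuous (V : normedModType C) (g : V -> R) :
  (forall u v, `|g u - g v| <= rnorm (u - v)) -> continuous g.
Proof.
move=> gV u; apply/cvgrPdist_lt => e e0.
have ue := (@cvg_rnormP V V (nbhs u) _ id u).2 cvg_id e e0.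
by near=> v; apply: le_lt_trans (gV _ _) _; near: v; exact: ue.
Unshelve. all: by end_near. Qed.

Lemma Re_continuous : continuous (@Re R : C -> R).
Proof.
by apply: rnorm_contraction_continuous => u v; rewrite -raddfB /= normr_Re_le.
Qed.

Lemma Im_continuous : continuous (@Im R : C -> R).
Proof.
by apply: rnorm_contraction_continuous => u v; rewrite -raddfB /= normr_Im_le.
Qed.

(** A square, because it is visibly the continuous image of a product of two compact segments. *)
Definition complex_square (M : R) : set C :=
  [set a | (`|Re a| <= M) && (`|Im a| <= M)].

Lemma complex_square_compact (M : R) : compact (complex_square M).
Proof.
have -> : complex_square M =
    (fun p : R * R => p.1%:C + 'i * p.2%:C) @` (`[- M, M] `*` `[- M, M]).
  apply/seteqP; split=> [a /andP[aM bM]|_ [[x y] [/= xM yM] <-]].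
    exists (Re a, Im a); first by split; rewrite /= in_itv /= -ler_norml.
    by rewrite /=; case: a {aM bM} => x y /=; simpc.
  rewrite /= in_itv /= -ler_norml in xM; rewrite /= in_itv /= -ler_norml in yM.
  by rewrite /complex_square /=; simpc; rewrite /= xM yM.
apply: continuous_compact; last first.
  by apply: compact_setX; exact: segment_compact.
apply: continuous_subspaceT => p; apply: cvgD.
  apply: (@cvg_comp _ _ _ fst (fun x : R => x%:C : C)); first exact: cvg_fst.
  exact: real_complex_continuous.
apply: cvgM; first exact: cvg_cst.
apply: (@cvg_comp _ _ _ snd (fun x : R => x%:C : C)); first exact: cvg_snd.
exact: real_complex_continuous.
Qed.

Lemma bounded_ultra_cvg T (G : set_system T) (UG : UltraFilter G) (g : T ->
  C) (M : R) :
  (\forall x \near G, rnorm (g x) <= M) -> exists l : C, g @ G --> l.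
Proof.
move=> gM; have := @complex_square_compact M; rewrite compact_ultra.
move=> /(_ (g @ G) _)[].
  apply: (@filterS _ G _ _ _ _ gM) => x gx.
  by rewrite /complex_square /= !(le_trans _ gx) ?normr_Re_le ?normr_Im_le.
by move=> l [_ gl]; exists l.
Qed.

(** In [R[i]] nonnegativity includes being real. It amounts to being equal to one's norm, a
    condition that passes to limits. *)
Lemma cvg_ge0 T (F : set_system T) (FF : ProperFilter F) (g : T -> C) (l : C) :
  g @ F --> l -> (\forall x \near F, 0 <= g x) -> 0 <= l.
Proof.
move=> gl g0; suff -> : l = `|l| by [].
apply: (cvg_unique _ gl); first exact: norm_hausdorff.
have : (fun x => `|g x|) @ F --> `|l| by apply: cvg_norm.
apply: cvg_trans; apply: near_eq_cvg; apply: filterS g0 => x gx.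
by rewrite ger0_norm.
Qed.

End ComplexNorm.

(** * Positive functionals and resolvents *)

Section StarAlgebraTheory.
Variables (R : realType) (A : starAlgType R).
Implicit Types x y : A.

Lemma star1 : star (1 : A) = 1.
Proof. by rewrite -[RHS]starK -[in RHS](mulr1 (star 1)) starM starK mulr1. Qed.

Lemma starN x : star (- x) = - star x.
Proof. by rewrite -[- x]scaleN1r starZ rmorphN1 scaleN1r. Qed.

Lemma starB x y : star (x - y) = star x - star y.
Proof. by rewrite starD starN. Qed.

Lemma ring_inv_unique (a b : A) : a * b = 1 -> b * a = 1 -> ring_inv a = b.
Proof.
move=> ab ba; apply: xget_unique => // c [_ ca].
by rewrite -[c]mulr1 -ab mulrA ca mul1r.
Qed.

End StarAlgebraTheory.

(* What the argument uses of the norm of a C*-algebra; C(X) is only a *-algebra,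
   and gets its sup norm below. *)
Record cstar_norm (R : realType) (A : starAlgType R) (N : A -> R) : Prop := {
  cnorm_ge0 : forall x, 0 <= N x ;
  cnormD_le : forall x y, N (x + y) <= N x + N y ;
  cnormZ_le : forall (a : R[i]) x, N (a *: x) <= rnorm a * N x ;
  cnormM_le : forall x y, N (x * y) <= N x * N y ;
  cnorm_star_le : forall x, N (star x) <= N x ;
  cnorm1_le : N 1 <= 1 ;
  cnorm_sqrt : forall h, star h = h -> N h < 1 ->
    exists2 y, star y = y & y * y = 1 - h ;
  cnorm_inv : forall x, N x < 1 ->
    exists y, (1 - x) * y = 1 /\ y * (1 - x) = 1 }.

Section CStarNorm.
Variables (R : realType) (A : starAlgType R) (N : A -> R).
Hypothesis NA : cstar_norm N.
Local Notation C := R[i].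
Implicit Types x y h : A.

Lemma cstar_normN x : N (- x) <= N x.
Proof.
by rewrite -scaleN1r (le_trans (cnormZ_le NA _ _)) // rnormN rnorm1 mul1r.
Qed.

Lemma cstar_normB x y : N (x - y) <= N x + N y.
Proof. by rewrite (le_trans (cnormD_le NA _ _)) // lerD2l cstar_normN. Qed.

Lemma cstar_normX x n : N (x ^+ n) <= N x ^+ n.
Proof.
elim: n => [|n IHn]; first by rewrite !expr0 (cnorm1_le NA).
rewrite !exprS (le_trans (cnormM_le NA _ _)) // ler_wpM2l //.
exact: (cnorm_ge0 NA).
Qed.

Lemma cstar_norm_sum I (r : seq I) (F : I -> A) :
  N (\sum_(i <- r) F i) <= \sum_(i <- r) N (F i).
Proof.
elim: r => [|i r IHr]; last first.
  by rewrite !big_cons (le_trans (cnormD_le NA _ _)) // lerD2l.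
by rewrite !big_nil -(scale0r (0 : A)) (le_trans (cnormZ_le NA _ _)) //
  rnorm0 mul0r.
Qed.

Section PositiveFunctional.
Variable rho : {scalar A}.
Hypothesis rho_pos : positive_functional rho.

Lemma rho1_ge0 : 0 <= rho 1.
Proof. by have := rho_pos 1; rewrite star1 mulr1. Qed.

(** [1 - h] and [1 + h] are squares of selfadjoint elements, so [rho 1 - rho h] and [rho 1 + rho h]
    are nonnegative; in the order of [R[i]] this also makes [rho h] real. *)
Lemma rho_selfadjoint_lt1 h : star h = h -> N h < 1 ->
  (rho h \is Num.real) && (rnorm (rho h) <= rnorm (rho 1)).
Proof.
move=> hh h1; have [y sy yy] := cnorm_sqrt NA hh h1.
have hN : star (- h) = - h by rewrite starN hh.
have [v sv vv] := cnorm_sqrt NA hN (le_lt_trans (cstar_normN h) h1).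
have := rho_pos y; rewrite sy yy linearB subr_ge0 => le1.
have := rho_pos v; rewrite sv vv opprK linearD -lerBlDl sub0r => le2.
have hr : rho h \is Num.real.
  by rewrite (ler_real le1) ger0_real // rho1_ge0.
rewrite hr -lecR -!rnormE (ger0_norm rho1_ge0) real_ler_norml // le1.
by rewrite le2.
Qed.

Lemma rho_selfadjoint h : star h = h ->
  (rho h \is Num.real) /\ rnorm (rho h) <= N h * rnorm (rho 1).
Proof.
(* The square root requires norm less than 1, so [h] is divided by some [t > N h], and [t] decreases
   to [N h]. *)
move=> hh; suff bnd t : N h < t ->
  (rho h \is Num.real) /\ rnorm (rho h) <= t * rnorm (rho 1).
  split; first by case: (bnd (N h + 1)); rewrite ?ltrDl.
  apply/ler_addgt0Pr => e e0; have k0 : 0 < rnorm (rho 1) + 1.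
    by rewrite ltr_wpDl ?rnorm_ge0.
  have ht : N h < N h + e / (rnorm (rho 1) + 1) by rewrite ltrDl divr_gt0.
  have [_ b] := bnd _ ht; apply: le_trans b _.
  rewrite mulrDl lerD2l mulrAC ler_pdivrMr // ler_pM2l //.
  by rewrite lerDl.
move=> ht; have t0 : 0 < t by apply: le_lt_trans ht; exact: (cnorm_ge0 NA).
have tC : t%:C != 0 :> C by rewrite eq_complex /= gt_eqF.
have sth : star (t^-1%:C *: h) = t^-1%:C *: h.
  by rewrite starZ hh; congr (_ *: _); rewrite conj_Creal // complex_real.
have Nth : N (t^-1%:C *: h) < 1.
  apply: le_lt_trans (cnormZ_le NA _ _) _;
    rewrite rnorm_real gtr0_norm ?invr_gt0 //.
  by rewrite mulrC ltr_pdivrMr // mul1r.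
have /andP[] := rho_selfadjoint_lt1 sth Nth.
rewrite linearZ /= => hr; rewrite rnormM rnorm_real gtr0_norm ?invr_gt0 //.
rewrite mulrC ler_pdivrMr // mulrC => hle; split=> //.
have -> : rho h = t%:C * (t^-1%:C * rho h)
  by rewrite mulrA -rmorphM mulfV ?gt_eqF // mul1r.
by rewrite rpredM // complex_real.
Qed.

Let sa1 x : star (x + star x) = x + star x.
Proof. by rewrite starD starK addrC. Qed.

Let sa2 x : star ('i *: (x - star x)) = 'i *: (x - star x).
Proof. by rewrite starZ conjCi starB starK scaleNr -scalerN opprB. Qed.

Let rho_parts x : 2 * rho x = rho (x + star x) - 'i * rho ('i *: (x - star x)).
Proof.
have -> : rho ('i *: (x - star x)) = 'i * rho (x - star x) by rewrite linearZ.
rewrite mulrA -expr2 sqrCi mulN1r opprK -linearD addrACA subrr addr0.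
by rewrite linearD mulr_natl mulr2n.
Qed.

(** The selfadjoint elements [x + star x] and ['i *: (x - star x)] are bounded separately, at the
    cost of the factor 2. *)
Lemma rho_bound x : rnorm (rho x) <= 2 * N x * rnorm (rho 1).
Proof.
have [_ b1] := rho_selfadjoint (sa1 x); have [_ b2] := rho_selfadjoint (sa2 x).
have h1 : N (x + star x) <= 2 * N x.
  by rewrite mulr_natl mulr2n (le_trans (cnormD_le NA _ _)) //
    lerD2l (cnorm_star_le NA).
have h2 : N ('i *: (x - star x)) <= 2 * N x.
  apply: le_trans (cnormZ_le NA _ _) _; rewrite {1}/rnorm normCi mul1r.
  by rewrite mulr_natl mulr2n (le_trans (cstar_normB _ _)) //
    lerD2l (cnorm_star_le NA).
have r0 : 0 <= rnorm (rho 1) by exact: rnorm_ge0.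
have : rnorm (2 * rho x) <= 2 * N x * rnorm (rho 1) + 2 * N x * rnorm (rho 1).
  rewrite rho_parts (le_trans (rnormB _ _)) // lerD //.
    by rewrite (le_trans b1) // ler_wpM2r.
  by rewrite rnormM {1}/rnorm normCi mul1r (le_trans b2) // ler_wpM2r.
have -> : rnorm (2 * rho x) = 2 * rnorm (rho x).
  by rewrite rnormM; congr (_ * _); rewrite /rnorm normr_nat.
by move: (rnorm (rho x)) => u; move: (2 * N x * _) => v; lra.
Qed.

Lemma rho_star x : rho (star x) = (rho x)^*%R.
Proof.
have [/CrealP r1 _] := rho_selfadjoint (sa1 x).
have [/CrealP r2 _] := rho_selfadjoint (sa2 x).
have r2' : rho ('i *: (star x - x)) = - rho ('i *: (x - star x)).
  by rewrite -linearN -scalerN opprB.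
apply: (@mulfI _ 2); first by rewrite pnatr_eq0.
have -> : 2 * (rho x)^*%R = (2 * rho x)^*%R by rewrite rmorphM rmorph_nat.
rewrite !rho_parts starK r2' addrC [star x + x]addrC rmorphB rmorphM /= r1 r2.
by rewrite conjCi mulNr opprK mulrN opprK addrC.
Qed.

End PositiveFunctional.

Section Resolvent.

Definition resolvent x : A := ring_inv (1 - x).

Lemma resolventP x : N x < 1 ->
  (1 - x) * resolvent x = 1 /\ resolvent x * (1 - x) = 1.
Proof.
by move=> /(cnorm_inv NA)[y [xy yx]];
  rewrite /resolvent (ring_inv_unique xy yx).
Qed.

Lemma resolventE x : N x < 1 -> resolvent x = 1 + x * resolvent x.
Proof.
by move=> /resolventP[+ _]; rewrite mulrBl mul1r => /eqP;
  rewrite subr_eq => /eqP.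
Qed.

Lemma resolventEr x : N x < 1 -> resolvent x = 1 + resolvent x * x.
Proof.
by move=> /resolventP[_ +]; rewrite mulrBr mulr1 => /eqP;
  rewrite subr_eq => /eqP.
Qed.

Lemma resolvent_norm x : N x < 1 -> N (resolvent x) <= (1 - N x)^-1.
Proof.
move=> x1; have d0 : 0 < 1 - N x by rewrite subr_gt0.
rewrite -[leRHS]mul1r ler_pdivlMr // mulrBr mulr1 lerBlDr.
rewrite {1}resolventE // (le_trans (cnormD_le NA _ _)) //
  lerD ?(cnorm1_le NA) //.
by rewrite mulrC (cnormM_le NA).
Qed.

(** Thanks to the exact remainder, the expansion of a |-> f (a z) below involves no infinite
    series. *)
Lemma resolvent_expand x n : N x < 1 ->
  resolvent x = \sum_(j < n) x ^+ j + x ^+ n * resolvent x.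
Proof.
move=> x1; elim: n => [|n IHn]; first by rewrite big_ord0 add0r mul1r.
by rewrite big_ord_recr /= {1}IHn -addrA exprSr -mulrA -[X in _ + (X +
  _)]mulr1 -mulrDr -resolventE.
Qed.

Lemma resolventB x y : N x < 1 -> N y < 1 ->
  resolvent y - resolvent x = resolvent y * (y - x) * resolvent x.
Proof.
move=> /resolventP[x1 _] /resolventP[_ y1].
have -> : y - x = (1 - x) - (1 - y) by rewrite opprB [RHS]addrC addrA subrK.
by rewrite mulrBr mulrBl y1 mul1r -mulrA x1 mulr1.
Qed.

Lemma cayley_Re_ge0 (rho : {scalar A}) x : positive_functional rho -> N x < 1 ->
  0 <= Re (rho (2 *: resolvent x - 1)).
Proof.
move=> rho_pos x1; set Q := resolvent x.
have sx1 : N (star x) < 1 by apply: le_lt_trans x1; exact: (cnorm_star_le NA).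
have [y sy yy] : exists2 y, star y = y & y * y = 1 - x * star x.
  apply: (cnorm_sqrt NA); first by rewrite starM starK.
  apply: le_lt_trans (cnormM_le NA _ _) _; apply: mulr_ilt1 => //;
    exact: (cnorm_ge0 NA).
have Qx : Q * x = Q - 1 by rewrite {2}/Q resolventEr // [1 + _]addrC addrK.
have xQ : star x * star Q = star Q - 1 by rewrite -starM Qx starB star1.
(* Positivity at [y * star Q] says that [rho (Q * (1 - x * star x) * star Q)] is nonnegative. With
   [Q * x = Q - 1] the argument collapses to [Q + star Q - 1], half the sum of [2 *: Q - 1] and its
   adjoint. *)
have := rho_pos (y * star Q); rewrite starM starK sy mulrA -(mulrA Q) yy.
rewrite mulrBr mulr1 (mulrA Q) Qx mulrBl -(mulrA (Q - 1)) xQ.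
have -> : Q * star Q - (Q - 1) * (star Q - 1) = Q + star Q - 1.
  rewrite mulrBr mulr1 mulrBl mul1r !opprB addrC -!addrA addNr addr0.
  by rewrite [-1 + _]addrC.
move=> pos.
have : 0 <= rho (2 *: Q - 1) + (rho (2 *: Q - 1))^*%R.
  rewrite -(rho_star rho_pos) -linearD starB starZ star1 rmorph_nat.
  have -> : 2 *: Q - 1 + (2 *: star Q - 1) = 2 *: (Q + star Q - 1).
    by rewrite addrACA -scalerDr scalerBr -opprD (scaler_nat 2 1).
  by rewrite linearZ /= mulr_ge0.
case: (rho _) => u v; rewrite lecE /= => /andP[_].
by rewrite -mulr2n pmulrn_lge0.
Qed.

End Resolvent.
End CStarNorm.

(** * Herglotz classes *)

(** The filter is the trace on [P] of the neighbourhoods of [f]. Testing the topology on singletons,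
    which are compact, leaves pointwise convergence. *)
Lemma closure_compactly_in_cvg (U : topologicalType) (V : uniformType) (D :
  set U)
    (P : set (U -> V)) (f : U -> V) :
  closure (P : set {family compactly_in D, U -> V}) f ->
  exists F : set_system (U -> V), [/\ ProperFilter F, F P &
    forall x, D x -> (fun g => g x) @ F --> f x].
Proof.
move=> Pf; pose fF : {family compactly_in D, U -> V} := f.
exists (within P (nbhs fF)); split.
- exact: (@within_nbhs_proper {family compactly_in D, U -> V} P fF Pf).
- by apply: withinT; exact: nbhs_filter.
move=> x Dx.
have FF : Filter (nbhs fF) by exact: nbhs_filter.
have fam : compactly_in D [set x].
  by split; [move=> _ -> | exact: compact_set1].
have /(@fam_cvgP _ _ (compactly_in D) (nbhs fF) f FF)/(_ _ fam) : nbhs fF -->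
  fF by [].
rewrite uniform_set1; apply: cvg_trans.
by apply: cvg_app; exact: cvg_within.
Qed.

Section Herglotz.
Variables (R : realType) (d : nat) (A : starAlgType R) (N : A ->
  R) (T : 'I_d -> A).
Local Notation C := R[i].
Local Notation ball := (uball R d).
Implicit Types (f g : 'rV[C]_d -> C) (z w : 'rV[C]_d).
Hypothesis NA : cstar_norm N.

Definition lincomb z : A := \sum_j z 0 j *: T j.

Hypothesis lincomb_lt1 : forall z, ball z -> N (lincomb z) < 1.

Lemma uball0 : ball 0.
Proof. by rewrite /uball /= big1 ?ltr01 // => j _;
  rewrite mxE normr0 expr0n. Qed.

Lemma lincombZ (a : C) z : lincomb (a *: z) = a *: lincomb z.
Proof. by rewrite scaler_sumr; apply: eq_bigr => j _; rewrite mxE scalerA. Qed.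

Lemma HkernelE z : Hkernel z T = 2 *: resolvent (lincomb z) - 1.
Proof. by []. Qed.

Lemma Hkernel0 : Hkernel 0 T = 1.
Proof.
rewrite HkernelE -(scale0r 0) lincombZ scale0r /resolvent subr0.
by rewrite (@ring_inv_unique _ _ 1 1) ?mulr1 // scaler_nat mulr2n addrK.
Qed.

(** The kernel is 1 at [z = 0], so the total mass [rho 1] is read off [f 0]. Together with
    [rho_bound], convergence at the single point 0 bounds the functionals of the approximants on
    each element. *)
Lemma herglotz_at0 (rho : {scalar A}) f : positive_functional rho ->
    (forall z, ball z -> f z = rho (Hkernel z T) + 'i * (Im (f 0))%:C) ->
  rnorm (rho 1) <= 2 * rnorm (f 0).
Proof.
move=> rho_pos /(_ 0 uball0); rewrite Hkernel0 => /(canLR (addrK _)) <-.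
rewrite (le_trans (rnormB _ _)) // mulr_natl mulr2n lerD2l rnormM rnorm_real.
by rewrite {1}/rnorm normCi mul1r normr_Im_le.
Qed.

(* The functionals of the approximants are bounded on each element of A, so they
   converge pointwise along an ultrafilter. *)
Lemma herglotz_closed (F : set_system ('rV[C]_d -> C)) f : ProperFilter F ->
    F (herglotz_class T) -> (forall z, ball z -> (fun g => g z) @ F --> f z) ->
  herglotz_class T f.
Proof.
move=> PF FP Ff; have [G [UG FG]] := ultraFilterLemma PF.
have GP : G (herglotz_class T) by exact: FG.
have Gf z : ball z -> (fun g => g z) @ G --> f z.
  by move=> /Ff; apply: cvg_trans => B; exact: FG.
have [g0 [rho0 _ _]] := filter_ex GP.
(* Functions outside the class receive the arbitrary functional [rho0]; [G] does not see them. *)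
have /choice[rho rhoP] : forall g, exists rho : {scalar A}, herglotz_class T
  g ->
    positive_functional rho /\
    forall z, ball z -> g z = rho (Hkernel z T) + 'i * (Im (g 0))%:C.
  move=> g; have [[rho rp rE]|nPg] := pselect (herglotz_class T g).
    by exists rho.
  by exists rho0 => /nPg.
(* One factor 2 comes from [rho_bound], the other from [herglotz_at0]; the 1 is the distance
   eventually allowed between [g 0] and [f 0]. *)
have Gnear a : \forall g \near G, rnorm (rho g a) <=
  2 * N a * (2 * (rnorm (f 0) + 1)).
  have near1 := (cvg_rnormP _ _).2 (Gf 0 uball0) 1 ltr01.
  near=> g; have [|rp rE] := rhoP g; first by near: g.
  apply: le_trans (rho_bound NA rp a) _; apply: ler_wpM2l.
    by rewrite mulr_ge0 // (cnorm_ge0 NA).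
  apply: le_trans (herglotz_at0 rp rE) _; rewrite ler_pM2l //.
  have -> : g 0 = f 0 - (f 0 - g 0) by rewrite subKr.
  rewrite (le_trans (rnormB _ _)) // lerD2l ltW //.
  by near: g; exact: near1.
have /choice[ell ellP] : forall a, exists l : C, (fun g => rho g a) @ G --> l.
  by move=> a; exact: bounded_ultra_cvg (Gnear a).
have ell_lin : scalar ell.
  move=> c x y; apply: (cvg_unique (@norm_hausdorff _ _) (ellP _)).
  have -> : (fun g => rho g (c *: x + y)) = (fun g => c * rho g x + rho g y).
    by apply/funext => g; rewrite linearP.
  by apply: cvgD (ellP y); apply: cvgM (ellP x); exact: cvg_cst.
pose ellL := GRing.isLinear.Build C A C *%R ell ell_lin.
pose L : {scalar A} := HB.pack ell ellL.
exists L => [a|z bz].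
  apply: (cvg_ge0 _ (ellP _)); apply: filterS GP => g /rhoP[rp _]; exact: rp.
apply: (cvg_unique (@norm_hausdorff _ _) (Gf z bz)).
have : (fun g => rho g (Hkernel z T) + 'i * (Im (g 0))%:C) @ G
    --> L (Hkernel z T) + 'i * (Im (f 0))%:C.
  apply: cvgD; first exact: ellP.
  apply: cvgM; first exact: cvg_cst.
  have c1 : (fun g => Im (g 0)) @ G --> Im (f 0).
    refine (cvg_comp (fun g : 'rV[C]_d -> C => g 0) (@Im R) (Gf 0 uball0) _).
    exact: (@Im_continuous R (f 0)).
  refine (cvg_comp _ _ c1 _).
  exact: (@real_complex_continuous R (Im (f 0))).
apply: cvg_trans; apply: near_eq_cvg.
by apply: filterS GP => g /rhoP[_ rE]; rewrite [RHS](rE z bz).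
Unshelve. all: by end_near. Qed.

Lemma herglotz_Re f z : herglotz_class T f -> ball z -> 0 <= Re (f z).
Proof.
move=> [rho rp fE] bz; rewrite fE // HkernelE.
have := cayley_Re_ge0 NA rp (lincomb_lt1 bz).
by case: (rho _) => u v /=; simpc.
Qed.

Lemma herglotz0 : herglotz_class T (fun=> 0).
Proof.
exists (\0 : {scalar A}) => [a|z _] //=.
by rewrite mulr0 add0r.
Qed.

Lemma herglotz_cone (s t : R) f g : 0 <= s -> 0 <= t ->
  herglotz_class T f -> herglotz_class T g ->
  herglotz_class T (fun z => s%:C * f z + t%:C * g z).
Proof.
move=> s0 t0 [rho rp rE] [tau tp tE].
have lin : scalar (fun a => s%:C * rho a + t%:C * tau a).
  by move=> c x y; rewrite !linearP /=; ring.
pose m := GRing.isLinear.Build C A C *%R _ lin.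
pose L : {scalar A} := HB.pack (fun a => s%:C * rho a + t%:C * tau a) m.
exists L => [a|z bz] /=; first by rewrite addr_ge0 // mulr_ge0 ?ler0c //.
have -> : Im (s%:C * f 0 + t%:C * g 0) = s * Im (f 0) + t * Im (g 0).
  by case: (f 0) (g 0) => [a b] [a' b'] /=; ring.
by rewrite (rE z bz) (tE z bz) rmorphD !rmorphM /=; ring.
Qed.

Lemma uballZ (a : C) z : rnorm a <= 1 -> ball z -> ball (a *: z).
Proof.
rewrite /uball /= => a1; apply: le_lt_trans; apply: ler_sum => j _.
rewrite mxE normrM exprMn ler_piMl ?exprn_ge0 // exprn_ile1 //.
by rewrite rnormE lecR.
Qed.

Hypothesis gauge : forall a : C, rnorm a = 1 ->
  exists2 Phi : {lrmorphism A -> A},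
    (forall x, Phi (star x) = star (Phi x)) & forall j, Phi (T j) = a *: T j.

(** [Phi] carries two-sided inverses to two-sided inverses, so the functional of the rotated
    function is [rho \o Phi]; the imaginary constant is the same because rotations fix 0. *)
Lemma herglotz_rotation (a : C) f : rnorm a = 1 -> herglotz_class T f ->
  herglotz_class T (fun z => f (a *: z)).
Proof.
move=> a1 [rho rp rE]; have [Phi Phi_star PhiT] := gauge a1.
exists (rho \o Phi : {scalar A}) => [x|z bz] /=;
  first by rewrite rmorphM /= Phi_star.
rewrite scaler0 rE; last by apply: uballZ => //; rewrite a1.
congr (rho _ + _); rewrite !HkernelE linearB linearZ /= rmorph1;
  congr (_ *: _ - _).
have [h1 h2] := resolventP NA (lincomb_lt1 bz).
have PhiL : Phi (lincomb z) = lincomb (a *: z).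
  rewrite linear_sum lincombZ scaler_sumr; apply: eq_bigr => j _.
  by rewrite linearZ /= PhiT !scalerA mulrC.
apply: ring_inv_unique; rewrite -PhiL -(rmorph1 Phi) -rmorphB -rmorphM.
  by rewrite h1.
by rewrite h2.
Qed.

End Herglotz.

(** * Neighbourhoods in the Euclidean ball and holomorphy *)

Section RowVectorNorm.
Variables (R : realType) (d : nat).
Implicit Types z h : 'rV[R[i]]_d.

Lemma rnorm_coord z j : rnorm (z 0 j) <= rnorm z.
Proof.
apply/ler_addgt0Pr => e e0.
have [_ /(_ 0 j)] : ball (0 : 'rV[R[i]]_d) (rnorm z + e)%:C z.
  by rewrite mx_norm_ball /ball_ /= sub0r normrN rnormE ltcR ltrDl.
by rewrite -ball_normE /ball_ /= mxE sub0r normrN rnormE ltcR => /ltW.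
Qed.

Lemma uballE z : uball R d z <-> \sum_j rnorm (z 0 j) ^+ 2 < 1.
Proof.
rewrite -ltcR rmorph_sum /= /uball /=.
by under [X in _ <-> is_true (X < _)]eq_bigr do rewrite rmorphXn /= -rnormE.
Qed.

Lemma uball_near z : uball R d z ->
  \forall h \near (0 : 'rV[R[i]]_d), uball R d (h + z).
Proof.
move=> /uballE; set s := (X in X < 1) => s1.
(* For [rnorm h < 1], each coordinate adds at most [(2 * rnorm z + 1) * rnorm h] to the sum of
   squares; the final 1 makes [K] positive even for [d = 0]. *)
pose K := d%:R * (2 * rnorm z + 1) + 1.
have K0 : 0 < K by rewrite ltr_wpDl // mulr_ge0 // addr_ge0 //
  mulr_ge0 ?rnorm_ge0.
have e0 : 0 < (1 - s) / K by rewrite divr_gt0 // subr_gt0.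
have small (e : R) : 0 < e -> \forall h \near (0 : 'rV[R[i]]_d), rnorm h < e.
  move=> e'; have H := (@cvg_rnormP _ _ _ (nbhs (0 : 'rV[R[i]]_d)) _ id 0).2
    cvg_id e e'.
  by near=> h; rewrite -[h]subr0 rnormC; near: h; exact: H.
have h1 := small _ e0; have h2 := small 1 ltr01.
near=> h; apply/uballE.
have hs : rnorm h < (1 - s) / K by near: h; exact: h1.
have hl : rnorm h < 1 by near: h; exact: h2.
apply: (@le_lt_trans _ _ (s + (K - 1) * rnorm h)).
  have -> : (K - 1) * rnorm h = \sum_(j < d) ((2 * rnorm z + 1) * rnorm h).
    by rewrite sumr_const card_ord -[RHS]mulr_natl /K addrK mulrA.
  rewrite /s -big_split /=; apply: ler_sum => j _; rewrite mxE.
  have := rnormD (h 0 j) (z 0 j); have := rnorm_coord h j;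
    have := rnorm_coord z j.
  have := rnorm_ge0 (h 0 j); have := rnorm_ge0 (z 0 j);
    have := rnorm_ge0 (h 0 j + z 0 j).
  move: hl; move: (rnorm h) (rnorm z) (rnorm (h 0 j)) (rnorm (z 0 j)) (rnorm
    _) => a b a' b' c.
  move=> *; nra.
have : K * rnorm h < 1 - s by rewrite mulrC -ltr_pdivlMr.
have := rnorm_ge0 h; move: (rnorm h) => a; nra.
Unshelve. all: by end_near. Qed.

End RowVectorNorm.

Lemma differentiable_quadratic (R : realType) (V W : normedModType R[i])
    (f : V -> W) (L : {linear V -> W}) (x : V) (b K : R) :
  (forall h, rnorm (L h) <= b * rnorm h) ->
  (\forall h \near (0 : V), rnorm (f (h +
    x) - f x - L h) <= K * rnorm h ^+ 2) ->
  differentiable f x.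
Proof.
move=> Lb fK.
have small (u : V) (e : R) : 0 < e -> \forall v \near u, rnorm (u - v) < e.
  exact: ((@cvg_rnormP _ _ _ (nbhs u) _ id u).2 cvg_id e).
have Lc : continuous L.
  move=> u; apply/cvg_rnormP => e e0.
  have b0 : 0 < `|b| + 1 by rewrite ltr_wpDl.
  have ue := small u _ (divr_gt0 e0 b0).
  near=> v; have uv : rnorm (u - v) < e / (`|b| + 1) by near: v; exact: ue.
  rewrite -linearB (le_lt_trans (Lb _)) //.
  apply: (@le_lt_trans _ _ ((`|b| + 1) * rnorm (u - v))).
    by rewrite ler_wpM2r ?rnorm_ge0 // (le_trans (ler_norm b)) // lerDl.
  by rewrite mulrC -ltr_pdivlMr.
have fL : f \o shift x = cst (f x) + L +o_ (0 : V) id.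
  apply/eqaddoP => e e0.
  have eE : e = (Re e)%:C by rewrite RRe_real // gtr0_real.
  have re0 : 0 < Re e by rewrite -ltcR -eE.
  have k0 : 0 < `|K| + 1 by rewrite ltr_wpDl.
  have H := small 0 _ (divr_gt0 re0 k0).
  near=> h; rewrite eE !rnormE -rmorphM lecR /= !fctE opprD addrA.
  have hs : rnorm (0 - h) < Re e / (`|K| + 1) by near: h; exact: H.
  have hK : rnorm (f (h + x) - f x - L h) <= K * rnorm h ^+ 2 by near: h;
    exact: fK.
  apply: le_trans hK _; rewrite expr2 mulrA ler_wpM2r ?rnorm_ge0 //.
  rewrite rnormC subr0 in hs.
  apply: (@le_trans _ _ ((`|K| + 1) * rnorm h)).
    by rewrite ler_wpM2r ?rnorm_ge0 // (le_trans (ler_norm K)) // lerDl.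
  by rewrite mulrC -ler_pdivlMr // ltW.
by apply/diff_locallyP; rewrite (diff_unique Lc fL).
Unshelve. all: by end_near. Qed.

Section HerglotzHolomorphic.
Variables (R : realType) (d : nat) (A : starAlgType R) (N : A ->
  R) (T : 'I_d -> A).
Local Notation C := R[i].
Hypothesis NA : cstar_norm N.
Hypothesis lincomb_lt1 : forall z, uball R d z -> N (lincomb T z) < 1.

Lemma lincomb_norm h : N (lincomb T h) <= (\sum_j N (T j)) * rnorm h.
Proof.
rewrite (le_trans (cstar_norm_sum NA _ _)) // mulr_suml; apply: ler_sum => j _.
rewrite (le_trans (cnormZ_le NA _ _)) // mulrC ler_wpM2l ?rnorm_coord //.
exact: (cnorm_ge0 NA).
Qed.

Lemma lincombD z w : lincomb T (z + w) = lincomb T z + lincomb T w.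
Proof. by rewrite -big_split; apply: eq_bigr => j _; rewrite mxE scalerDl. Qed.

Lemma herglotz_holomorphic : herglotz_class T `<=` @holomorphic R d.
Proof.
move=> f [rho rp fE] z bz; set x := lincomb T z; set Q := resolvent x.
have x1 : N x < 1 := lincomb_lt1 bz.
(* The derivative of the resolvent in the direction [h] is [Q * lincomb T h * Q]. *)
have lin : linear (fun h => 2 * rho (Q * lincomb T h * Q) : C).
  move=> a u v;
    rewrite lincombD lincombZ mulrDr mulrDl -scalerAr -scalerAl linearP /=.
  by rewrite mulrDr mulrCA.
pose m := GRing.isLinear.Build C 'rV[C]_d C *:%R _ lin.
pose L : {linear 'rV[C]_d ->
  C} := HB.pack (fun h => 2 * rho (Q * lincomb T h * Q) : C) m.
set B := \sum_j N (T j).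
have N0 := cnorm_ge0 NA.
have B0 : 0 <= B by apply: sumr_ge0.
set r := rnorm (rho 1); have r0 : 0 <= r by exact: rnorm_ge0.
have two a : rnorm (2 * rho a) <= 4 * N a * r.
  have := rho_bound NA rp a; rewrite -/r rnormM.
  have -> : rnorm (2 : C) = 2
    by rewrite -[2](rmorph_nat (real_complex R)) rnorm_real normr_nat.
  by move: (rnorm _) (N a) => u v; lra.
apply: (@differentiable_quadratic R _ _ f L z (4 * (N Q ^+ 2 * B) * r)
   (4 * (2 / (1 - N x) * (B ^+ 2 * N Q ^+ 2)) * r)).
  move=> h; apply: le_trans (two _) _.
  rewrite [leRHS]mulrAC ler_wpM2r // -[leRHS]mulrA ler_wpM2l //.
  apply: le_trans (cnormM_le NA _ _) _.
  apply: le_trans (ler_wpM2r (N0 _) (cnormM_le NA _ _)) _.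
  rewrite mulrAC -expr2 -[leRHS]mulrA ler_wpM2l ?sqr_ge0 //.
  exact: lincomb_norm.
have d0 : 0 < 1 - N x by rewrite subr_gt0.
(* This radius gives [N a <= (1 - N x) / 2] below, so the resolvent at [y] is bounded by
   [2 / (1 - N x)], uniformly in [h]. *)
have e0 : 0 < (1 - N x) / 2 / (B + 1) by rewrite !divr_gt0 // ltr_wpDl.
have H1 := uball_near bz.
have H2 := (@cvg_rnormP _ _ _ (nbhs (0 : 'rV[C]_d)) _ id 0).2 cvg_id _ e0.
near=> h.
have bh : uball R d (h + z) by near: h; exact: H1.
have : rnorm (0 - h) < (1 - N x) / 2 / (B + 1) by near: h; exact: H2.
rewrite rnormC subr0 ltr_pdivlMr ?ltr_wpDl // => hs.
set a := lincomb T h; have aB : N a <= B * rnorm h by exact: lincomb_norm.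
set y := lincomb T (h + z); have yE : y = a + x by exact: lincombD.
have y1 : N y <= 1 - (1 - N x) / 2.
  rewrite yE (le_trans (cnormD_le NA _ _)) //.
  have arith (na nx nh b : R) : nh * (b + 1) < (1 - nx) / 2 -> na <= b * nh ->
      0 <= nh -> na + nx <= 1 - (1 - nx) / 2 by move=> *; lra.
  exact: arith hs aB (rnorm_ge0 h).
have yl1 : N y < 1 by apply: le_lt_trans y1 _; rewrite ltrBlDr ltrDl divr_gt0.
(* The resolvent identity is used twice: it gives [resolvent y = Q + E], and inserting this into [E]
   gives [E = Q * a * Q + E * a * Q], whose last term is quadratic in [h]. *)
set E := resolvent y * a * Q.
have Qy : resolvent y = Q + E.
  by rewrite /E -[a](addrK x) -yE -(resolventB NA x1 yl1) addrC subrK.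
rewrite (fE _ bh) (fE _ bz) !HkernelE -/x -/y -/Q /=.
have -> : rho (2 *: resolvent y - 1) + 'i * (Im (f 0))%:C -
    (rho (2 *: Q - 1) + 'i * (Im (f 0))%:C) - 2 * rho (Q * a * Q) =
    2 * rho (E * a * Q).
  have rE : rho E = rho (Q * a * Q) + rho (E * a * Q).
    by rewrite {1}/E Qy -linearD -!mulrDl.
  have rB u : rho (2 *: u - 1) = 2 * rho u - rho 1 by rewrite linearB linearZ.
  by rewrite !rB Qy linearD rE /=; ring.
apply: le_trans (two _) _;
  rewrite /E [leRHS]mulrAC ler_wpM2r // -[leRHS]mulrA ler_wpM2l //.
have Qyn : N (resolvent y) <= 2 / (1 - N x).
  apply: le_trans (resolvent_norm NA yl1) _.
  rewrite -[leRHS]invf_div lef_pV2 ?posrE ?divr_gt0 ?subr_gt0 //.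
  by move: y1; lra.
have step u v b c : N u <= b -> N v <= c -> 0 <= b -> N (u * v) <= b * c.
  move=> ub vc b0; apply: le_trans (cnormM_le NA _ _) _.
  by apply: ler_pM.
have t0 : 0 <= 2 / (1 - N x) by rewrite divr_ge0 // ltW.
have Bh0 : 0 <= B * rnorm h by rewrite mulr_ge0 ?rnorm_ge0.
have s1 := step _ _ _ _ Qyn aB t0.
have s2 := step _ _ _ _ s1 (lexx (N Q)) (mulr_ge0 t0 Bh0).
have s3 := step _ _ _ _ s2 aB (mulr_ge0 (mulr_ge0 t0 Bh0) (N0 Q)).
have s4 := step _ _ _ _ s3 (lexx (N Q))
  (mulr_ge0 (mulr_ge0 (mulr_ge0 t0 Bh0) (N0 Q)) Bh0).
apply: le_trans s4 _.
by rewrite le_eqVlt; apply/orP; left; apply/eqP; ring.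
Unshelve. all: by end_near. Qed.

End HerglotzHolomorphic.

(** * Discretized Poisson kernel *)

Section DiscretePoisson.
Variable R : realType.
Local Notation C := R[i].

(** [X^n - 1] is separable and splits over [R[i]]; its n distinct roots include a primitive one. *)
Lemma exists_primitive_root n : (0 < n)%N -> exists w : C, n.-primitive_root w.
Proof.
move=> n0; pose p : {poly C} := 'X^n - 1;
  have [s Dp] := closed_field_poly_normal p.
rewrite (monicP _) ?monicXnsubC // scale1r in Dp.
have sn1 : all n.-unity_root s by apply/allP => z; rewrite -root_prod_XsubC -Dp.
have sz : (n < (size s).+1)%N
  by rewrite -(size_prod_XsubC s id) -Dp size_XnsubC.
have us : uniq s.
  by rewrite -separable_prod_XsubC -Dp separable_Xn_sub_1 // pnatr_eq0 -lt0n.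
by have /hasP[w _ wn] := has_prim_root n0 sn1 us sz; exists w.
Qed.

Lemma rnorm_prim_root n (w : C) : n.-primitive_root w -> rnorm w = 1.
Proof.
move=> wn; have n0 := prim_order_gt0 wn.
have /(congr1 (@rnorm R _)) := prim_expr_order wn; rewrite rnormX rnorm1.
by move/eqP; rewrite pexpr_eq1 ?rnorm_ge0 // => /eqP.
Qed.

(** Orthogonality of the characters of Z/n. Distinct exponents below n give distinct powers of [w],
    and the geometric sum of their ratio vanishes. *)
Lemma sum_prim_root n (w : C) a b : n.-primitive_root w -> (a < n)%N ->
  (b < n)%N ->
  \sum_(k < n) (w ^+ k) ^+ a * ((w ^+ k) ^+ b)^*%R = (a == b)%:R * n%:R.
Proof.
move=> wn an bn; have w1 := rnorm_prim_root wn.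
have w0 : w != 0 by apply/eqP => w0; move: w1; rewrite w0 rnorm0 => /eqP;
  rewrite eq_sym oner_eq0.
have cw m : (w ^+ m)^*%R = (w ^+ m)^-1.
  rewrite rmorphXn /= -exprVn; congr (_ ^+ _).
  by rewrite invC_norm rnormE w1 expr1n invr1 mul1r.
pose x := w ^+ a / w ^+ b.
have -> : \sum_(k < n) (w ^+ k) ^+ a * ((w ^+ k) ^+ b)^*%R =
  \sum_(k < n) x ^+ k.
  apply: eq_bigr => k _; rewrite -!exprM cw /x exprMn exprVn -!exprM.
  by rewrite ![(k * _)%N]mulnC.
have x1 : (x == 1) = (a == b).
  rewrite -(inj_eq (mulIf (expf_neq0 b w0))) /x mulfVK ?expf_neq0 // mul1r.
  by rewrite (eq_prim_root_expr wn) !modn_small.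
rewrite -x1; have [->|xn1] := eqVneq x 1.
  by under eq_bigr do rewrite expr1n; rewrite sumr_const card_ord mul1r.
rewrite mul0r; apply: (mulfI (_ : x - 1 != 0)); first by rewrite subr_eq0.
rewrite -subrX1 mulr0 /x exprMn exprVn -!exprM ![(_ * n)%N]mulnC !exprM.
by rewrite (prim_expr_order wn) !expr1n invr1 mulr1 subrr.
Qed.

(* Discretization of the Poisson kernel: the moments of order j < M of these
   weights on the circle are close to r ^ j. *)
Lemma poisson_weights (r : R) M : 0 <= r < 1 -> (0 < M)%N ->
  exists (w : nat -> R) (o : nat -> C),
    [/\ forall k, 0 <= w k, forall k, rnorm (o k) = 1 &
     forall j, (j < M)%N -> \sum_(k < M.*2) (w k)%:C * o k ^+ j
        = (r ^+ j * (1 - r ^+ (M - j).*2))%:C].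
Proof.
move=> /andP[r0 r1] M0; have M20 : (0 < M.*2)%N by rewrite double_gt0.
have [w0 wM] := exists_primitive_root M20.
(* [p] truncates 1 / (1 - r o) at order M, so (1 - r^2) |p|^2 is a nonnegative substitute for the
   Poisson kernel (1 - r^2) / |1 - r o|^2; [c] also divides by the number of nodes. With [M.*2]
   nodes the exponents [j + l] and [m] stay below the order of the root, so there is no aliasing. *)
pose o k := w0 ^+ k; pose p k := \sum_(l < M) (r ^+ l)%:C * o k ^+ l.
pose c := (1 - r ^+ 2) / (M.*2)%:R.
exists (fun k => c * rnorm (p k) ^+ 2), o; split => [k|k|j jM].
- by rewrite mulr_ge0 ?sqr_ge0 // divr_ge0 // subr_ge0 exprn_ile1 // ltW.
- by rewrite /o rnormX (rnorm_prim_root wM) expr1n.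
have cr (x : R) : (x%:C)^*%R = x%:C :> C by rewrite conj_Creal // complex_real.
have pE k : (c * rnorm (p k) ^+ 2)%:C * o k ^+ j = \sum_(l < M) \sum_(m < M)
    (c * r ^+ (l + m))%:C * (o k ^+ (j + l) * (o k ^+ m)^*%R).
  rewrite rmorphM rmorphXn /= -rnormE normCK.
  rewrite [X in _ * X^*%R]/p rmorph_sum /= mulr_suml mulr_sumr mulr_suml.
  apply: eq_bigr => l _; rewrite mulr_sumr mulr_sumr mulr_suml.
  apply: eq_bigr => m _.
  rewrite (rmorphM (@Num.conj C)) /= cr.
  by rewrite !rmorphM /= !exprD !rmorphM /=; ring.
under eq_bigr do rewrite pE.
rewrite exchange_big /=; under eq_bigr do rewrite exchange_big /=.
have inner (l m : 'I_M) : \sum_(k < M.*2) (c * r ^+ (l + m))%:C *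
    (o k ^+ (j + l) * (o k ^+ m)^*%R) =
    ((1 - r ^+ 2) * ((j + l == m)%N%:R * r ^+ (l + m)))%:C.
  rewrite -mulr_sumr (sum_prim_root wM); last first.
  - by rewrite -addnn ltn_addr.
  - by rewrite -addnn -addSn leq_add // ltnW.
  rewrite -!(rmorph_nat (real_complex R)) -!rmorphM /=; congr _%:C.
  rewrite /c; field; by rewrite pnatr_eq0 -lt0n.
under eq_bigr do under eq_bigr do rewrite inner.
under eq_bigr do rewrite -rmorph_sum /= -mulr_sumr.
rewrite -rmorph_sum /= -mulr_sumr; congr _%:C.
(* Only [m = j + l] survives, and it is below [M] exactly when [l < M - j]; the missing tail of the
   geometric series causes the factor [1 - r ^+ (M - j).*2]. *)
have -> : \sum_(l < M) \sum_(m < M) (j + l == m)%N%:R * r ^+ (l + m) =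
    \sum_(l < M - j) r ^+ j * (r ^+ 2) ^+ l.
  rewrite (big_ord_widen M (fun l => r ^+ j * (r ^+ 2) ^+ l) (leq_subr j M)).
  rewrite [RHS]big_mkcond; apply: eq_bigr => l _; rewrite ltn_subRL.
  case: ifPn => [jl|]; last first.
    rewrite -leqNgt => jl; apply: big1 => m _.
    by rewrite gtn_eqF ?mul0r // (leq_trans (ltn_ord m)).
  rewrite (bigD1 (Ordinal jl)) //= eqxx mul1r big1 ?addr0 => [|m mjl].
    by rewrite -exprM -exprD; congr (_ ^+ _);
      rewrite mul2n -addnn addnCA addnA addnC addnA addnC.
  by rewrite -val_eqE /= eq_sym in mjl; rewrite (negbTE mjl) mul0r.
rewrite -mulr_sumr mulrCA; congr (_ * _).
by rewrite -muln2 mulnC exprM -[1 - r ^+ 2]opprB mulNr -subrX1 opprB.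
Qed.

(** To be applied to g (a) = f (a z). The two terms K q^M bound the truncation at order M, at [r]
    and at the nodes. The moment errors r^(2M - j) are at most r^M, and summing them against the
    coefficients yields K / (1 - q) * r^M. *)
Lemma poisson_estimate (r q K : R) (alpha : nat -> C) (g : C -> C) M
    (w : nat -> R) (o : nat -> C) :
  0 <= r < 1 -> 0 <= q < 1 -> (0 < M)%N ->
  (forall k, 0 <= w k) -> (forall k, rnorm (o k) = 1) ->
  (forall j, (j < M)%N -> \sum_(k < M.*2) (w k)%:C * o k ^+ j
        = (r ^+ j * (1 - r ^+ (M - j).*2))%:C) ->
  (forall j, rnorm (alpha j) <= K * q ^+ j) ->
  (forall a, rnorm a <= 1 ->
     rnorm (g a - \sum_(j < M) a ^+ j * alpha j) <= K * q ^+ M) ->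
  rnorm (g r%:C - \sum_(k < M.*2) (w k)%:C * g (o k)) <=
    (2 * K + K / (1 - q)) * (q ^+ M + r ^+ M).
Proof.
move=> /andP[r0 r1] /andP[q0 q1] M0 w0 o1 wo alphaK gK.
have K0 : 0 <= K by have := alphaK 0%N; rewrite expr0 mulr1; apply: le_trans;
  exact: rnorm_ge0.
pose S a := \sum_(j < M) a ^+ j * alpha j.
have -> : g r%:C - \sum_(k < M.*2) (w k)%:C * g (o k) =
  (g r%:C - S r%:C) + (S r%:C - \sum_(k < M.*2) (w k)%:C * S (o k)) -
  \sum_(k < M.*2) (w k)%:C * (g (o k) - S (o k)).
  have -> : \sum_(k < M.*2) (w k)%:C * (g (o k) - S (o k)) =
      \sum_(k < M.*2) (w k)%:C * g (o k) - \sum_(k < M.*2) (w k)%:C * S (o k).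
    by rewrite -sumrB; apply: eq_bigr => k _; rewrite mulrBr.
  ring.
have e1 : rnorm (g r%:C - S r%:C) <= K * q ^+ M.
  by apply: gK; rewrite rnorm_real ger0_norm // ltW.
have e3 : rnorm (\sum_(k < M.*2) (w k)%:C * (g (o k) - S (o k))) <= K * q ^+ M.
  apply: le_trans (rnorm_sum _ _ _) _.
  apply: (@le_trans _ _ (\sum_(k < M.*2) w k * (K * q ^+ M))).
    apply: ler_sum => k _; rewrite rnormM rnorm_real ger0_norm // ler_wpM2l //.
    by apply: gK; rewrite o1.
  (* By the moment of order 0, the total weight is [1 - r ^+ M.*2], hence at most 1. *)
  rewrite -mulr_suml ler_piMl ?mulr_ge0 ?exprn_ge0 //.
  have := wo 0%N M0; under eq_bigr do rewrite expr0 mulr1.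
  rewrite -rmorph_sum /= => /complexI ->.
  by rewrite expr0 mul1r lerBlDr lerDl exprn_ge0.
have e2 : rnorm (S r%:C - \sum_(k < M.*2) (w k)%:C * S (o k)) <=
  K / (1 - q) * r ^+ M.
  have -> : \sum_(k < M.*2) (w k)%:C * S (o k) =
      \sum_(j < M) (r ^+ j * (1 - r ^+ (M - j).*2))%:C * alpha j.
    under eq_bigr do rewrite mulr_sumr.
    rewrite exchange_big /=; apply: eq_bigr => j _; rewrite -wo // mulr_suml.
    by apply: eq_bigr => k _; rewrite mulrA.
  rewrite /S -sumrB; apply: le_trans (rnorm_sum _ _ _) _.
  apply: (@le_trans _ _ (\sum_(j < M) K * r ^+ M * q ^+ j)).
    apply: ler_sum => j _; rewrite -mulrBl -rmorphXn -rmorphB /= rnormM.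
    have -> : r ^+ j - r ^+ j * (1 - r ^+ (M - j).*2) = r ^+ (j + (M - j).*2).
      by rewrite exprD; ring.
    rewrite rnorm_real ger0_norm ?exprn_ge0 // [leRHS]mulrAC mulrC.
    apply: ler_pM; rewrite ?rnorm_ge0 ?exprn_ge0 //.
    rewrite ler_wiXn2l // ?ltW // -addnn addnA subnKC ?leq_addr //.
    exact: ltnW.
  rewrite -mulr_sumr [leLHS]mulrAC ler_wpM2r ?exprn_ge0 // ler_wpM2l //.
  have d0 : 0 < 1 - q by rewrite subr_gt0.
  rewrite -[leRHS]mul1r ler_pdivlMr // mulrC -opprB mulNr -subrX1 opprB.
  by rewrite lerBlDr lerDl exprn_ge0.
apply: le_trans (rnormB _ _) _.
have q' : 0 <= q ^+ M by exact: exprn_ge0.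
have r' : 0 <= r ^+ M by exact: exprn_ge0.
have k' : 0 <= K / (1 - q) by rewrite divr_ge0 // subr_ge0 ltW.
have e12 := rnormD (g r%:C - S r%:C) (S r%:C - \sum_(k < M.*2) (w k)%:C * S
  (o k)).
move: e1 e2 e3 e12;
  move: (rnorm _) (rnorm _) (rnorm _) (rnorm _) => a1 a2 a3 a4.
move: q' r' k'; move: (q ^+ M) (r ^+ M) (K / _) => b1 b2 b3 *.
nra.
Qed.

End DiscretePoisson.

(** * Dilations *)

Section HerglotzPositiveClass.
Variables (R : realType) (d : nat) (A : starAlgType R) (N : A ->
  R) (T : 'I_d -> A).
Local Notation C := R[i].
Hypothesis NA : cstar_norm N.
Hypothesis lincomb_lt1 : forall z, uball R d z -> N (lincomb T z) < 1.
Hypothesis gauge : forall a : C, rnorm a = 1 ->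
  exists2 Phi : {lrmorphism A -> A},
    (forall x, Phi (star x) = star (Phi x)) & forall j, Phi (T j) = a *: T j.

Lemma herglotz_sum (w : nat -> R) (f : nat -> 'rV[C]_d -> C) n :
  (forall k, 0 <= w k) -> (forall k, herglotz_class T (f k)) ->
  herglotz_class T (fun z => \sum_(k < n) (w k)%:C * f k z).
Proof.
move=> w0 Pf; elim: n => [|n IHn].
  by under eq_fun do rewrite big_ord0; exact: herglotz0.
have := herglotz_cone ler01 (w0 n) IHn (Pf n).
by congr herglotz_class; apply/funext => z; rewrite big_ord_recr /= mul1r.
Qed.

(** The order [n.+1] guarantees a term j = 0, which absorbs the constant [c - rho 1]. In the 4, one
    factor 2 belongs to the kernel [2 *: resolvent _ - 1], the other to [rho_bound]. *)
Lemma herglotz_expansion (rho : {scalar A}) (c : C) x (a : C) n :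
  positive_functional rho -> N x < 1 -> rnorm a <= 1 ->
  rnorm (rho (2 *: resolvent (a *: x) - 1) + c -
    \sum_(j < n.+1) a ^+ j * ((j == 0%N :> nat)%:R * (c - rho 1) +
      2 * rho (x ^+ j)))
  <= 4 / (1 - N x) * rnorm (rho 1) * N x ^+ n.+1.
Proof.
move=> rp x1 a1; have ax1 : N (a *: x) <= N x.
  apply: le_trans (cnormZ_le NA _ _) _; rewrite ler_piMl //;
    exact: (cnorm_ge0 NA).
have ax1' : N (a *: x) < 1 by apply: le_lt_trans x1.
have -> : \sum_(j < n.+1) a ^+ j * ((j == 0%N :> nat)%:R * (c - rho 1) +
  2 * rho (x ^+ j)) =
    (c - rho 1) + 2 * rho (\sum_(j < n.+1) (a *: x) ^+ j).
  under eq_bigr do rewrite mulrDr.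
  rewrite big_split /= big_ord_recl expr0 !mul1r big1 ?addr0 => [|j _];
    last first.
    by rewrite mul0r mulr0.
  congr (_ + _); rewrite linear_sum mulr_sumr; apply: eq_bigr => j _.
  by rewrite exprZn linearZ /= mulrCA.
rewrite {1}(resolvent_expand NA n.+1 ax1'); set S := \sum_(j < n.+1) _.
set Q := resolvent _; set y := _ ^+ n.+1 * Q.
have -> : rho (2 *: (S + y) - 1) + c - (c - rho 1 + 2 * rho S) = 2 * rho y.
  by rewrite linearB linearZ linearD /=; ring.
have -> : rnorm (2 * rho y) = 2 * rnorm (rho y).
  by rewrite rnormM; congr (_ * _); rewrite /rnorm normr_nat.
have yb : N y <= N x ^+ n.+1 * (1 - N x)^-1.
  apply: le_trans (cnormM_le NA _ _) _; apply: ler_pM;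
    rewrite ?(cnorm_ge0 NA) //.
    apply: le_trans (cstar_normX NA _ _) _.
    by rewrite lerXn2r // nnegrE (cnorm_ge0 NA).
  apply: le_trans (resolvent_norm NA ax1') _.
  by rewrite lef_pV2 ?posrE ?subr_gt0 // lerB.
have := rho_bound NA rp y; have r0 := rnorm_ge0 (rho 1).
have := ler_wpM2r r0 yb;
  move: (rnorm (rho y)) (rnorm (rho 1)) (N y) (N x ^+ _) ((1 - N x)^-1).
by move=> s1 s2 s3 s4 s5 *; nra.
Qed.

Lemma herglotz_dilation (r : R) f : 0 <= r <= 1 -> herglotz_class T f ->
  herglotz_class T (dilation r f).
Proof.
(* The weights require [r < 1]; at [r = 1] the dilation is the identity. *)
move=> /andP[r0]; rewrite le_eqVlt => /orP[/eqP-> Pf|r1 Pf].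
  by rewrite /dilation (_ : (fun z => _) = f) //; apply/funext => z;
    rewrite scale1r.
have r01 : 0 <= r < 1 by rewrite r0.
have /choice[w wP] := fun M => @poisson_weights R r M.+1 r01 isT.
have /choice[u wo] := wP.
pose fM M z := \sum_(k < M.+1.*2) (w M k)%:C * f (u M k *: z).
have PfM M : herglotz_class T (fM M).
  have [w0 o1 _] := wo M;
    exact: (@herglotz_sum (w M) (fun k z => f (u M k *: z)) _ w0
    (fun k => herglotz_rotation NA lincomb_lt1 gauge (o1 k) Pf)).
have FP : (fM @ \oo) (herglotz_class T) by exists 0%N => // M _; exact: PfM.
apply: (herglotz_closed NA _ FP) => z bz.
have [rho rp fE] := Pf; set x := lincomb T z;
  have x1 : N x < 1 := lincomb_lt1 bz.
pose q := N x; pose c := 'i * (Im (f 0))%:C.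
pose alpha j : C := (j == 0%N :> nat)%:R * (c - rho 1) + 2 * rho (x ^+ j).
(* The first summand serves the truncation error and the coefficients [2 * rho (x ^+ j)], the second
   the constant in [alpha 0]. *)
pose K := 4 / (1 - q) * rnorm (rho 1) + rnorm (c - rho 1).
have q0 : 0 <= q by exact: (cnorm_ge0 NA).
have q01 : 0 <= q < 1 by rewrite q0.
have i1 : 1 <= (1 - q)^-1 by rewrite invf_ge1 ?subr_gt0 // lerBlDr lerDl.
have n0 := rnorm_ge0 (rho 1); have n1 := rnorm_ge0 (c - rho 1).
have alphaK j : rnorm (alpha j) <= K * q ^+ j.
  have qj : 0 <= q ^+ j by exact: exprn_ge0.
  apply: le_trans (rnormD _ _) _.
  have e1 : rnorm ((j == 0%N :> nat)%:R * (c - rho 1)) <=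
    rnorm (c - rho 1) * q ^+ j.
    case: j {qj} => [|j] /=; first by rewrite mul1r expr0 mulr1.
    by rewrite mul0r rnorm0 mulr_ge0 // exprn_ge0.
  have e2 : rnorm (2 * rho (x ^+ j)) <= 4 / (1 - q) * rnorm (rho 1) * q ^+ j.
    have -> : rnorm (2 * rho (x ^+ j)) = 2 * rnorm (rho (x ^+ j)).
      by rewrite rnormM; congr (_ * _); rewrite /rnorm normr_nat.
    have b1 := rho_bound NA rp (x ^+ j);
      have b2 := ler_wpM2r n0 (cstar_normX NA x j).
    have b3 := ler_wpM2r (mulr_ge0 n0 qj) i1.
    move: b1 b2 b3; rewrite -/q;
      move: (rnorm (rho (x ^+ j))) (rnorm (rho 1)) (N (x ^+ j)) (q ^+ j) ((1
      - q)^-1).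
    by move=> s1 s2 s3 s4 s5 *; nra.
  by rewrite [leLHS]addrC; apply: le_trans (lerD e2 e1) _; rewrite -mulrDl.
have gK M (a : C) : rnorm a <= 1 ->
    rnorm (f (a *: z) - \sum_(j < M.+1) a ^+ j * alpha j) <= K * q ^+ M.+1.
  move=> a1; rewrite fE ?HkernelE ?lincombZ; last exact: uballZ.
  apply: le_trans (herglotz_expansion c M rp x1 a1) _.
  by rewrite ler_wpM2r ?exprn_ge0 // /K lerDl.
have est M : rnorm (dilation r f z - fM M z) <= (2 * K +
  K / (1 - q)) * (q ^+ M.+1 + r ^+ M.+1).
  have [w0 o1 wE] := wo M.
  exact: (@poisson_estimate R r q K alpha (fun a => f (a *: z)) M.+1 (w M) (u M)
    r01 q01 isT w0 o1 wE alphaK (gK M)).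
apply/cvg_rnormP => e e0.
have lim0 : (fun M => (2 * K + K / (1 - q)) * (q ^+ M.+1 + r ^+ M.+1)) @ \oo -->
    (2 * K + K / (1 - q)) * (0 + 0).
  apply: cvgM; first exact: cvg_cst.
  have cvg_expS (t : R) : 0 <= t < 1 -> (fun M => t ^+ M.+1) @ \oo --> (0 : R).
    move=> /andP[t0 t1]; have /cvg_expr : `|t| < 1 by rewrite ger0_norm.
    by rewrite -(cvg_shiftS (GRing.exp t : nat -> R)).
  by apply: cvgD; exact: cvg_expS.
rewrite addr0 mulr0 in lim0.
have /cvgrPdist_lt/(_ e e0) := lim0; apply: filterS => M.
rewrite sub0r normrN => /(le_lt_trans (ler_norm _)); exact: le_lt_trans.
Unshelve. all: by end_near. Qed.

Theorem positive_class_herglotz : positive_class (herglotz_class T).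
Proof.
split.
- exact: (herglotz_holomorphic NA lincomb_lt1).
- by move=> f Pf z bz; exact: (herglotz_Re NA lincomb_lt1 Pf bz).
- by exists (fun=> 0); exact: herglotz0.
- by move=> s t f g s0 t0; exact: herglotz_cone.
- move=> f _ /closure_compactly_in_cvg[F [PF FP Ff]].
  exact: (herglotz_closed NA PF FP).
- exact: herglotz_dilation.
Qed.

End HerglotzPositiveClass.

(** * C*-algebras *)

Section CStarAlgebraNorm.
Variables (R : realType) (A : cstarAlgType R).
Implicit Types (x y h l : A).

Lemma cnormZE (c : R[i]) x : cnorm (c *: x) = rnorm c * cnorm x.
Proof. by apply: complexI; rewrite cnormZ rmorphM /= -rnormE. Qed.

Lemma cnormN x : cnorm (- x) = cnorm x.
Proof. by rewrite -[- x]scaleN1r cnormZE rnormN rnorm1 mul1r. Qed.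

Lemma cnormC x y : cnorm (x - y) = cnorm (y - x).
Proof. by rewrite -cnormN opprB. Qed.

Lemma cnorm0 : cnorm (0 : A) = 0.
Proof. by rewrite -(scale0r (0 : A)) cnormZE rnorm0 mul0r. Qed.

Lemma cstar_cnorm_ge0 x : 0 <= cnorm x.
Proof. by have := cnormD x (- x);
  rewrite subrr cnorm0 cnormN -mulr2n pmulrn_lge0. Qed.

Lemma cnorm_starE x : cnorm (star x) = cnorm x.
Proof.
suff le y : cnorm y <= cnorm (star y).
  by apply/eqP; rewrite eq_le le andbT -{2}[x]starK le.
have := cnorm_star y; have := cnormM (star y) y; have := cstar_cnorm_ge0 y.
rewrite le_eqVlt => /orP[/eqP<- _ _|y0 + yE]; first exact: cstar_cnorm_ge0.
by rewrite yE expr2 ler_pM2r.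
Qed.

Lemma cnorm1 : cnorm (1 : A) <= 1.
Proof.
have := cnorm_star (1 : A); rewrite star1 mulr1;
  have := cstar_cnorm_ge0 (1 : A).
move: (cnorm 1) => u; rewrite le_eqVlt => /orP[/eqP<- _|u0]; first exact: ler01.
by move=> uu; nra.
Qed.

Lemma cnormX x n : cnorm (x ^+ n) <= cnorm x ^+ n.
Proof.
elim: n => [|n IHn]; first by rewrite !expr0 cnorm1.
by rewrite !exprS (le_trans (cnormM _ _)) // ler_wpM2l // cstar_cnorm_ge0.
Qed.

(** Replaces the continuity of the operations: an equation passes to the limit [l] once its defect
    is dominated by distances from [u] to [l]. The index [n.+1] accommodates increments and
    recurrences. *)
Lemma cnorm_small (u : nat -> A) l x (k : R) :
  (cnorm (u n - l)) @[n --> \oo] --> (0 : R) ->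
  (forall n, cnorm x <= k * cnorm (u n - l) + k * cnorm (u n.+1 - l)) -> x = 0.
Proof.
move=> ul xu; apply: cnorm_eq0; apply/eqP; rewrite eq_le cstar_cnorm_ge0 andbT.
have lim0 : (k * cnorm (u n - l) +
  k * cnorm (u n.+1 - l)) @[n --> \oo] --> k * 0 + k * 0.
  apply: cvgD; apply: cvgM => //; try exact: cvg_cst.
  by rewrite (cvg_shiftS (fun n => cnorm (u n - l) : R)).
rewrite mulr0 addr0 in lim0.
rewrite leNgt; apply/negP => x0; have /cvgrPdist_lt/(_ _ x0)[n _ nP] := lim0.
have := nP n (leqnn n); rewrite sub0r normrN => /(le_lt_trans (ler_norm _)).
by rewrite ltNge xu.
Qed.

Lemma geometric_cvg (u : nat -> A) (K q : R) : 0 <= q < 1 ->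
  (forall n, cnorm (u n.+1 - u n) <= K * q ^+ n) ->
  exists l, (cnorm (u n - l)) @[n --> \oo] --> (0 : R).
Proof.
move=> /andP[q0 q1] uq; apply: cnorm_complete => e e0.
have d0 : 0 < 1 - q by rewrite subr_gt0.
pose c := K / (1 - q).
have K0 : 0 <= K.
  by have := uq 0%N; rewrite expr0 mulr1; apply: le_trans;
    exact: cstar_cnorm_ge0.
have c0 : 0 <= c by rewrite divr_ge0 // ltW.
have cK : K = c * (1 - q) by rewrite /c mulfVK ?gt_eqF.
(* Keeping the difference of powers, instead of [q ^+ n] alone, lets the induction telescope. *)
have tail n m : cnorm (u (n + m)%N - u n) <= c * (q ^+ n - q ^+ (n + m)).
  elim: m => [|m IHm]; first by rewrite addn0 !subrr cnorm0 mulr0.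
  rewrite addnS -[u _.+1](subrK (u (n +
    m)%N)) -addrA (le_trans (cnormD _ _)) //.
  have := uq (n + m)%N; rewrite exprS {1}cK.
  by move: IHm; move: (cnorm _) (cnorm _) (q ^+ n) (q ^+ _) => a b s t; nra.
have cvgq : (c * q ^+ n) @[n --> \oo] --> c * 0.
  by apply: cvgM; [exact: cvg_cst|apply: cvg_expr; rewrite ger0_norm].
rewrite mulr0 in cvgq.
have e20 : 0 < e / 2 by rewrite divr_gt0.
have /cvgrPdist_lt/(_ _ e20)[n _ nP] := cvgq.
have qn : c * q ^+ n < e / 2.
  by have := nP n (leqnn n); rewrite sub0r normrN; apply: le_lt_trans;
    exact: ler_norm.
have near_n m : (n <= m)%N -> cnorm (u m - u n) < e / 2.
  move=> nm; apply: le_lt_trans qn; rewrite -(subnKC nm);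
    apply: le_trans (tail _ _) _.
  by rewrite ler_wpM2l // lerBlDr lerDl exprn_ge0.
exists n => m k /near_n mn /near_n kn.
rewrite -[u m](subrK (u n)) -addrA (le_lt_trans (cnormD _ _)) // (cnormC (u n)).
by rewrite [e]splitr ltrD.
Qed.

Lemma cstar_neumann x : cnorm x < 1 ->
  exists y, (1 - x) * y = 1 /\ y * (1 - x) = 1.
Proof.
move=> x1; have q01 : 0 <= cnorm x < 1 by rewrite cstar_cnorm_ge0.
pose u n : A := \sum_(i < n) x ^+ i.
have uS n : u n.+1 - u n = x ^+ n
  by rewrite /u big_ord_recr /= addrAC subrr add0r.
have [|l ul] := @geometric_cvg u 1 _ q01; first by move=> n;
  rewrite uS mul1r cnormX.
have ux n : (1 - x) * u n = 1 - x ^+ n.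
  by rewrite -[RHS]opprB subrX1 -mulNr opprB.
have uxr n : u n * (1 - x) = 1 - x ^+ n.
  rewrite -ux; apply: commr_sym; apply: commr_sum => i _; apply: commrX.
  by apply: commr_sym; apply: commrB => //; exact: commr1.
pose k := 1 + cnorm (1 - x).
(* [x ^+ n], the defect of the partial sum as an inverse, is an increment of [u]; this is the shape
   that [cnorm_small] expects. *)
have xn n : cnorm (x ^+ n) <= cnorm (u n.+1 - l) + cnorm (u n - l).
  rewrite -uS;
    have -> : u n.+1 - u n = (u n.+1 - l) + (l - u n) by rewrite addrA subrK.
  by rewrite (cnormC (u n)) (le_trans (cnormD _ _)).
exists l; split; apply/eqP; rewrite -subr_eq0; apply/eqP;
  apply: (cnorm_small (k := k) ul) => n.
  have -> : (1 - x) * l - 1 = (1 - x) * (l - u n) - x ^+ n.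
    by rewrite mulrBr ux opprB -addrA; congr (_ + _);
      rewrite addrAC subrr add0r.
  rewrite (le_trans (cnormD _ _)) //
    cnormN (le_trans (lerD (cnormM _ _) (xn n))) //.
  rewrite (cnormC l) /k; have := cstar_cnorm_ge0 (1 - x);
    have := cstar_cnorm_ge0 (u n - l).
  by have := cstar_cnorm_ge0 (u n.+1 - l);
    move: (cnorm _) (cnorm _) (cnorm _) => a b c; nra.
have -> : l * (1 - x) - 1 = (l - u n) * (1 - x) - x ^+ n.
  by rewrite mulrBl uxr opprB -addrA; congr (_ + _); rewrite addrAC subrr add0r.
rewrite (le_trans (cnormD _ _)) //
  cnormN (le_trans (lerD (cnormM _ _) (xn n))) //.
rewrite (cnormC l) /k; have := cstar_cnorm_ge0 (1 - x);
  have := cstar_cnorm_ge0 (u n - l).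
by have := cstar_cnorm_ge0 (u n.+1 - l);
  move: (cnorm _) (cnorm _) (cnorm _) => a b c; nra.
Qed.

(* 1 - sqrt (1 - h) is the fixed point of y |-> (h + y ^ 2) / 2, a contraction of
   the ball of radius |h|. *)
Lemma cstar_sqrt h : star h = h -> cnorm h < 1 ->
  exists2 y, star y = y & y * y = 1 - h.
Proof.
move=> sh h1; set q := cnorm h; have q0 : 0 <= q by exact: cstar_cnorm_ge0.
have q01 : 0 <= q < 1 by rewrite q0.
pose F y : A := (2^-1 : R[i]) *: (h + y * y).
pose u n := iter n F 0.
have half : rnorm (2^-1 : R[i]) = 2^-1.
  by rewrite rnormV; congr (_^-1); rewrite /rnorm normr_nat.
have su n : star (u n) = u n.
  elim: n => [|n IHn]; first by rewrite /u /= -(subrr (1 : A)) starB star1.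
  rewrite /u /= -/(u n) /F starZ starD starM sh IHn.
  by rewrite geC0_conj // invr_ge0.
have FB x y : cnorm (F x - F y) <= 2^-1 * ((cnorm x + cnorm y) * cnorm (x - y)).
  rewrite /F -scalerBr cnormZE half ler_wpM2l ?invr_ge0 //.
  have -> : h + x * x - (h + y * y) = x * (x - y) + (x - y) * y.
    by rewrite opprD addrACA subrr add0r mulrBr mulrBl addrA subrK.
  rewrite (le_trans (cnormD _ _)) // [leRHS]mulrDl.
  by rewrite lerD // (le_trans (cnormM _ _)) // mulrC.
have uq n : cnorm (u n) <= q.
  elim: n => [|n IHn]; first by rewrite /u /= cnorm0.
  rewrite /u /= -/(u n) /F cnormZE half.
  have := cnormD h (u n * u n); have := cnormM (u n) (u n);
    have := cstar_cnorm_ge0 (u n).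
  rewrite -/q; move: IHn q0 h1; rewrite -/q.
  by move: (cnorm (u n)) (cnorm (h + _)) (cnorm (_ * _)) q {q01} => a b c e *;
    nra.
(* By [FB] the increments shrink by the factor [(cnorm (u n.+1) + cnorm (u n)) / 2], which [uq]
   bounds by [q]. *)
have uK n : cnorm (u n.+1 - u n) <= cnorm (u 1%N - u 0%N) * q ^+ n.
  elim: n => [|n IHn]; first by rewrite expr0 mulr1.
  have arith (a b c s t e : R) : 0 <= e -> 0 <= b -> b <= a -> s <= e ->
    t <= e ->
      c <= 2^-1 * ((s + t) * b) -> c <= e * a.
    move=> e0 b0 ba se te; have := ler_wpM2r b0 se; have := ler_wpM2r b0 te.
    by have := ler_wpM2l e0 ba; rewrite mulrDl; lra.
  rewrite exprS mulrCA.
  exact: (arith _ _ _ _ _ _ q0 (cstar_cnorm_ge0 _) IHn (uq n.+1) (uq n) (FB _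
    _)).
have [l ul] := geometric_cvg q01 uK.
have Fl : F l = l.
  apply/eqP; rewrite -subr_eq0; apply/eqP.
  apply: (cnorm_small (k := 1 + q + cnorm l) ul) => n.
  have -> : F l - l = - (F (u n) - F l) + (u n.+1 - l).
    by rewrite opprB addrA subrK.
  rewrite (le_trans (cnormD _ _)) // cnormN.
  have := FB (u n) l; have := uq n; have := cstar_cnorm_ge0 (u n - l).
  have := cstar_cnorm_ge0 (u n.+1 - l); have := cstar_cnorm_ge0 l; move: q0.
  move: (cnorm l) (cnorm (u n - l)) (cnorm (u n.+1 - l)) (cnorm (u n)) (cnorm
    _) q {q01 uq uK} => a b c a' b' e *.
  nra.
have sl : star l = l.
  apply/eqP; rewrite -subr_eq0; apply/eqP;
    apply: (cnorm_small (k := 2) ul) => n.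
  have -> : star l - l = - star (u n - l) + (u n - l).
    by rewrite starB su opprB addrA subrK.
  rewrite (le_trans (cnormD _ _)) // cnormN cnorm_starE.
  have := cstar_cnorm_ge0 (u n - l); have := cstar_cnorm_ge0 (u n.+1 - l).
  by move: (cnorm _) (cnorm _) => a b; lra.
exists (1 - l); first by rewrite starB star1 sl.
(* The fixed point equation says h = 2 l - l^2, whence (1 - l)^2 = 1 - h. *)
have hl : h + l * l = l + l.
  by rewrite -[RHS]mulr2n -scaler_nat -{3}Fl /F scalerA mulfV ?pnatr_eq0 //
    scale1r.
have hE : h = l + l - l * l by rewrite -hl addrK.
rewrite mulrBl mul1r mulrBr mulr1 opprB hE opprB opprD -!addrA.
by congr (1 + _); rewrite addrCA.
Qed.

Lemma cstarAlg_norm : cstar_norm (@cnorm R A).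
Proof.
split.
- exact: cstar_cnorm_ge0.
- exact: cnormD.
- by move=> a x; rewrite cnormZE.
- exact: cnormM.
- by move=> x; rewrite cnorm_starE.
- exact: cnorm1.
- exact: cstar_sqrt.
- exact: cstar_neumann.
Qed.

End CStarAlgebraNorm.

(** * The Cuntz algebra *)

Section CuntzClass.
Variables (R : realType) (d : nat) (A : cstarAlgType R) (V : 'I_d -> A).

Lemma star_sum (B : starAlgType R) I (r : seq I) (F : I -> B) :
  star (\sum_(i <- r) F i) = \sum_(i <- r) star (F i).
Proof.
elim: r => [|i r IHr]; last by rewrite !big_cons starD IHr.
by rewrite !big_nil -(subrr (1 : B)) starB star1.
Qed.

Hypothesis Vcuntz : cuntz_algebra V.

(** The [V j] are isometries with orthogonal ranges, so the adjoint of z.V times z.V is the scalar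
    |z|^2, and the C*-identity gives the norm. *)
Lemma cuntz_lincomb_lt1 z : uball R d z -> cnorm (lincomb V z) < 1.
Proof.
have [[VV _] _ _] := Vcuntz; move=> /uballE zb.
have aa : star (lincomb V z) * lincomb V z =
  (\sum_j rnorm (z 0 j) ^+ 2)%:C *: 1.
  rewrite star_sum mulr_suml rmorph_sum /= scaler_suml; apply: eq_bigr => i _.
  rewrite mulr_sumr (bigD1 i) //= big1 => [|j ji].
    rewrite addr0 starZ -scalerAl -scalerAr VV eqxx scalerA rmorphXn /= -rnormE.
    by rewrite normCK mulrC.
  by rewrite starZ -scalerAl -scalerAr VV eq_sym (negbTE ji) !scaler0.
rewrite -(@ltr_pXn2r _ 2) ?nnegrE ?ler01 ?cstar_cnorm_ge0 //
  expr1n -cnorm_star aa.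
rewrite cnormZE rnorm_real ger0_norm; last by apply: sumr_ge0 => j _;
  exact: sqr_ge0.
apply: le_lt_trans zb; rewrite ler_piMr ?cnorm1 //.
by apply: sumr_ge0 => j _; exact: sqr_ge0.
Qed.

Lemma cuntz_gauge (a : R[i]) : rnorm a = 1 ->
  exists2 Phi : {lrmorphism A -> A},
    (forall x, Phi (star x) = star (Phi x)) & forall j, Phi (V j) = a *: V j.
Proof.
have [[VV V1] _ univ] := Vcuntz; move=> a1; apply: univ.
have aa : a * a^*%R = 1 by rewrite -normCK rnormE a1 expr1n.
split=> [i j|].
  by rewrite starZ -scalerAl -scalerAr scalerA mulrC aa scale1r VV.
rewrite -V1; apply: eq_bigr => j _.
by rewrite starZ -scalerAl -scalerAr scalerA aa scale1r.
Qed.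

Lemma positive_class_cuntz : positive_class (herglotz_class V).
Proof.
exact: positive_class_herglotz (cstarAlg_norm A) cuntz_lincomb_lt1 cuntz_gauge.
Qed.

End CuntzClass.

(** * The unit sphere *)

Section CompactContinuousFunctions.
Variables (R : realType) (X : ptopologicalType).
Local Notation CX := (continuousType X R[i]).
Hypothesis Xcompact : compact [set: X].
Implicit Types f g h : CX.

Definition sup_norm f : R := sup (range (fun x => rnorm (f x))).

Lemma rnorm_continuous (V : normedModType R[i]) : continuous (@rnorm R V).
Proof.
apply: rnorm_contraction_continuous => u v; rewrite ler_norml.
have := rnormD (u - v) v; have := rnormD (v - u) u; rewrite !subrK (rnormC v u).
by move: (rnorm u) (rnorm v) (rnorm _) => a b c *; lra.
Qed.

Lemma sup_norm_has_sup f : has_sup (range (fun x => rnorm (f x))).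
Proof.
split; first by exists (rnorm (f point)), point.
have /compact_bounded[M [_ MP]] : compact (range (fun x => rnorm (f x))).
  apply: continuous_compact Xcompact; apply: continuous_subspaceT => x.
  apply: (@continuous_comp _ _ _ (fun x => f x) (@rnorm R R[i]));
    first exact: cts_fun.
  exact: rnorm_continuous.
exists (M + 1) => _ [x _ <-].
have M1 : M < M + 1 by rewrite ltrDl.
have : `|rnorm (f x)| <= M + 1 by apply: (MP _ M1); exists x.
by rewrite ger0_norm ?rnorm_ge0.
Qed.

Lemma sup_norm_ub f x : rnorm (f x) <= sup_norm f.
Proof. by apply: sup_upper_bound (sup_norm_has_sup f) _ _; exists x. Qed.

Lemma sup_norm_le f (c : R) : (forall x, rnorm (f x) <= c) -> sup_norm f <= c.
Proof.
by move=> fc; apply: ge_sup => [|_ [x _ <-]//]; exists (rnorm (f point)), point.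
Qed.

(** Selfadjoint functions are real-valued, so square roots are taken pointwise; [sup_norm f < 1]
    keeps [1 - f] from vanishing, so inverses are pointwise too. *)
Lemma cf_norm : cstar_norm (sup_norm : CX -> R).
Proof.
split=> [f|f g|a f|f g|f||h sh h1|f f1].
- by apply: le_trans (sup_norm_ub f point); exact: rnorm_ge0.
- apply: sup_norm_le => x; apply: le_trans (rnormD (f x) (g x)) _.
  by rewrite lerD ?sup_norm_ub.
- apply: sup_norm_le => x; rewrite -[(a *: f) x]/(a * f x) rnormM.
  by rewrite ler_wpM2l ?rnorm_ge0 ?sup_norm_ub.
- apply: sup_norm_le => x; rewrite -[(f * g) x]/(f x * g x) rnormM.
  by rewrite ler_pM ?rnorm_ge0 ?sup_norm_ub.
- apply: sup_norm_le => x; rewrite -[star f x]/((f x)^*)%R rnorm_conj.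
  exact: sup_norm_ub.
- by apply: sup_norm_le => x; rewrite rnorm1.
- have hr x : h x = (Re (h x))%:C.
    by rewrite RRe_real //; apply/CrealP;
      rewrite -[RHS](congr1 (fun f : CX => f x) sh).
  have yc : continuous (fun x => (Num.sqrt (1 - Re (h x)))%:C : R[i]).
    move=> x; apply: (@continuous_comp _ _ _ (fun x => Num.sqrt (1 - Re (h x)))
      (fun t : R => t%:C : R[i])); last exact: real_complex_continuous.
    apply: (@continuous_comp _ _ _ (fun x => 1 - Re (h x)) Num.sqrt);
      last exact: sqrt_continuous.
    apply: cvgB; first exact: cvg_cst.
    apply: (@continuous_comp _ _ _ (fun x => h x) (@Re R));
      first exact: cts_fun.
    exact: Re_continuous.
  exists (mkcts yc : CX); apply: cfP => x.
    by rewrite -[LHS]/((Num.sqrt (1 - Re (h x)))%:C^*)%R conj_Creal //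
      complex_real.
  rewrite -[LHS]/((Num.sqrt (1 - Re (h x)))%:C * (Num.sqrt (1 - Re (h x)))%:C).
  rewrite -rmorphM -expr2 sqr_sqrtr; last first.
    rewrite subr_ge0; apply: le_trans (ler_norm _) _.
    by rewrite (le_trans (normr_Re_le _)) // (le_trans (sup_norm_ub _ _)) //
      ltW.
  by rewrite -[RHS]/(1 - h x) [in RHS]hr rmorphB.
- have f0 x : 1 - f x != 0.
    rewrite subr_eq0; apply/eqP => fx; have := sup_norm_ub f x.
    by rewrite -fx rnorm1 leNgt f1.
  have yc : continuous (fun x => (1 - f x)^-1 : R[i]).
    move=> x; apply: cvgV => //; apply: cvgB; first exact: cvg_cst.
    exact: cts_fun.
  exists (mkcts yc : CX); split; apply: cfP => x.
    by rewrite -[LHS]/((1 - f x) * (1 - f x)^-1) mulfV.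
  by rewrite -[LHS]/((1 - f x)^-1 * (1 - f x)) mulVf.
Qed.

End CompactContinuousFunctions.

Section SphereClass.
Variables (R : realType) (n : nat).
Local Notation C := R[i].
Local Notation X := (sphere_type R n).
Local Notation CX := (continuousType X C).

Lemma usphereE (z : 'rV[C]_n.+1) : usphere R n.+1 z <-> \sum_j rnorm (z 0 j)
  ^+ 2 = 1.
Proof.
have -> : usphere R n.+1 z <-> (\sum_j rnorm (z 0 j) ^+ 2)%:C = 1.
  by rewrite rmorph_sum /=; under eq_bigr do rewrite rmorphXn /= -rnormE.
by split=> [/complexI|->].
Qed.

Lemma sphereP (x : X) : \sum_j rnorm (\val x 0 j) ^+ 2 = 1.
Proof. by apply/usphereE; exact: set_mem (valP x). Qed.

(** The image of an ultrafilter converges in a compact cube of coordinates. Its limit lies on the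
    sphere because the sum of squares is continuous and constantly 1 along it, and neighbourhoods on
    the sphere are traces of ambient ones. *)
Lemma sphere_compact : compact [set: X].
Proof.
rewrite compact_ultra => G UG _.
have cube : compact [set v : 'rV[C]_n.+1 | forall j, complex_square 1 (v ord0
  j)].
  by apply: (@rV_compact _ _ (fun=> complex_square 1)) => _;
    exact: complex_square_compact.
rewrite compact_ultra in cube.
have [|p [_ Gp]] := cube ((fun x : X => \val x) @ G) (fmap_ultra _ UG).
  apply: (@filterS _ G _ setT); last exact: filterT.
  move=> x _ j; rewrite /complex_square /=.
  have xj : rnorm (\val x 0 j) <= 1.
    rewrite -(@ler_pXn2r _ 2) ?nnegrE ?rnorm_ge0 //
      expr1n -(sphereP x) (bigD1 j) //=.
    by rewrite lerDl sumr_ge0 // => i _; exact: sqr_ge0.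
  by rewrite !(le_trans _ xj) ?normr_Re_le ?normr_Im_le.
have Sc : continuous (fun z : 'rV[C]_n.+1 => \sum_j rnorm (z 0 j) ^+ 2).
  apply: continuous_big => [|j _ z]; first exact: add_continuous.
  apply: (@continuous_comp _ _ _ (fun z : 'rV[C]_n.+1 => z 0 j) (fun a : C =>
    rnorm a ^+ 2)).
    exact: coord_continuous.
  apply: (@continuous_comp _ _ _ (@rnorm R C) (fun t : R => t ^+ 2)).
    exact: rnorm_continuous.
  exact: exprn_continuous.
have p1 : \sum_j rnorm (p 0 j) ^+ 2 = 1.
  have c1 : (fun x : X => \sum_j rnorm (\val x 0 j) ^+ 2) @ G --> \sum_j
    rnorm (p 0 j) ^+ 2.
    exact: (cvg_comp _ _ Gp (Sc p)).
  have cst1 : (fun x : X => \sum_j rnorm (\val x 0 j) ^+ 2) = (fun=> 1).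
    by apply/funext => x; exact: sphereP.
  rewrite cst1 in c1; apply: (cvg_unique _ c1); first exact: norm_hausdorff.
  exact: cvg_cst.
have pS : p \in usphere R n.+1 by apply/mem_set/usphereE.
exists (exist _ p pS); split=> // B.
rewrite nbhsE => -[W [[U oU UW] Wp] WB].
apply: (filterS WB); rewrite -UW; apply: (Gp U).
by apply: open_nbhs_nbhs; split=> //; move: Wp; rewrite -UW.
Qed.

(** The supremum needs a bound uniform in [x] and strictly below 1. The arithmetic-geometric mean
    inequality gives [(s + 1) / 2], weaker than the square root of [s] from Cauchy-Schwarz but
    sufficient. *)
Lemma sphere_lincomb_lt1 z : uball R n.+1 z ->
  sup_norm (lincomb (@sphere_coord R n) z) < 1.
Proof.
move=> /uballE zb; set s := \sum_j _ in zb.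
apply: (@le_lt_trans _ _ ((s + 1) / 2)); last by move: zb; lra.
apply: sup_norm_le => x.
have -> : lincomb (@sphere_coord R n) z x = \sum_j z 0 j * \val x 0 j.
  apply: (big_morph (fun g : CX => g x)) => //.
apply: le_trans (rnorm_sum _ _ _) _.
have -> : (s + 1) / 2 = \sum_j (rnorm (z 0 j) ^+ 2 +
  rnorm (\val x 0 j) ^+ 2) / 2.
  by rewrite -mulr_suml big_split /= sphereP.
apply: ler_sum => j _; rewrite rnormM;
  move: (rnorm (z 0 j)) (rnorm (\val x 0 j)) => a b.
by have := sqr_ge0 (a - b); nra.
Qed.

Lemma sphere_rotate_subproof (a : C) (x : X) : rnorm a = 1 ->
  a *: \val x \in usphere R n.+1.
Proof.
move=> a1; apply/mem_set/usphereE; rewrite -[RHS](sphereP x).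
by apply: eq_bigr => j _; rewrite mxE rnormM a1 mul1r.
Qed.

Lemma sphere_gauge (a : C) : rnorm a = 1 ->
  exists2 Phi : {lrmorphism CX -> CX},
    (forall x, Phi (star x) = star (Phi x)) &
    forall j, Phi (@sphere_coord R n j) = a *: @sphere_coord R n j.
Proof.
move=> a1; pose m (x : X) : X :=
  exist (fun z => z \in usphere R n.+1) _ (sphere_rotate_subproof x a1).
have mc : continuous m.
  apply: continuous_comp_initial => x.
  apply: (@continuous_comp _ _ _ (fun x : X => \val x) (fun z => a *: z)).
    exact: initial_continuous.
  exact: scaler_continuous.
have fmc (f : CX) : continuous (fun x => f (m x)).
  by move=> x; apply: continuous_comp; [exact: mc|exact: cts_fun].
pose Phi f : CX := mkcts (fmc f).
have Phi_lin : linear Phi by move=> c f g; apply: cfP.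
have Phi_mul : monoid_morphism Phi by split=> [|f g]; apply: cfP.
pose l := GRing.isLinear.Build C CX CX *:%R Phi Phi_lin.
pose mm := GRing.isMonoidMorphism.Build CX CX Phi Phi_mul.
pose P : {lrmorphism CX -> CX} := HB.pack Phi l mm.
exists P => [f|j]; apply: cfP => x //.
by rewrite -[LHS]/((a *: \val x) 0 j) mxE.
Qed.

Lemma positive_class_sphere : positive_class (herglotz_class (@sphere_coord R
  n)).
Proof.
exact: (positive_class_herglotz (@cf_norm R X sphere_compact)
  sphere_lincomb_lt1 sphere_gauge).
Qed.

End SphereClass.

(** * The Drury-Arveson space *)

Section HilbertDensity.
Variables (R : realType) (H : hilbertType R).
Implicit Types (u v w l : H).
Local Notation dot := (@hdot R H).

Lemma rnorm_dot u : dot u u = (rnorm u ^+ 2)%:C.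
Proof. by rewrite -hdot_norm rnormE rmorphXn. Qed.

Lemma rnorm_CS u v : rnorm (dot u v) <= rnorm u * rnorm v.
Proof. by rewrite -lecR rmorphM /= -!rnormE dot_CS. Qed.

Lemma dot_suml I (r : seq I) (F : I -> H) w :
  dot (\sum_(i <- r) F i) w = \sum_(i <- r) dot (F i) w.
Proof. exact: (big_morph (fun u => dot u w) (fun a b =>
  dotDl a b w) (dot0l w)). Qed.

Lemma dot_sumr I (r : seq I) (F : I -> H) w :
  dot w (\sum_(i <- r) F i) = \sum_(i <- r) dot w (F i).
Proof. exact: (big_morph (fun u => dot w u) (fun a b =>
  dotDr a b w) (dot0r w)). Qed.

Lemma hilbert_cauchy (x : nat -> H) :
  (forall e : R, 0 < e -> exists N, forall n, (N <= n)%N ->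
    rnorm (x N - x n) < e) ->
  exists l, forall e : R, 0 < e -> exists N, forall n, (N <= n)%N ->
    rnorm (l - x n) < e.
Proof.
move=> xC; have xcvg : cvg (x @ \oo).
  apply: cauchy_cvg; apply: cauchy_exP => e e0.
  have eE : e = (Re e)%:C by rewrite RRe_real // gtr0_real.
  have re0 : 0 < Re e by rewrite -ltcR -eE.
  have [N NP] := xC _ re0; exists (x N); exists N => // n /= Nn.
  by rewrite -ball_normE /ball_ /= rnormE eE ltcR NP.
exists (lim (x @ \oo)) => e e0.
have [N _ NP] := (cvg_rnormP _ _).2 xcvg e e0.
by exists N => n Nn; exact: NP.
Qed.

(* A minimizing sequence of the distance from u to L converges to u. *)
Lemma orthogonal_dense (L : set H) : L 0 ->
  (forall c u v, L u -> L v -> L (c *: u + v)) ->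
  (forall u, (forall l, L l -> dot u l = 0) -> u = 0) ->
  forall u (e : R), 0 < e -> exists2 l, L l & rnorm (u - l) < e.
Proof.
move=> L0 Llin Lperp u e e0.
pose q v := rnorm v ^+ 2; pose Q := [set q (u - l) | l in L].
have Qinf : has_inf Q.
  by split; [exists (q (u - 0)), 0|exists 0 => _ [l _ <-]; exact: sqr_ge0].
set m := inf Q.
have mq l : L l -> m <= q (u - l) by move=> Ll; apply: ge_inf;
  [case: Qinf|exists l].
have apx n : exists l, L l /\ q (u - l) < m + n.+1%:R^-1.
  have n0 : 0 < n.+1%:R^-1 :> R by rewrite invr_gt0.
  by have [_ [l Ll <-] lm] := inf_adherent n0 Qinf; exists l.
have [x xP] := choice apx.
have xL n : L (x n) by case: (xP n).
have xq n : q (u - x n) < m + n.+1%:R^-1 by case: (xP n).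
have qC c v : q (c%:C *: v) = c ^+ 2 * q v.
  by rewrite /q rnormZ rnorm_real exprMn real_normK // num_real.
(* Parallelogram law; the midpoint of [x N] and [x n] is again in [L], so its distance to [u] is at
   least the infimum. *)
have xx N n : (N <= n)%N -> q (x N - x n) <= 4 * N.+1%:R^-1.
  move=> Nn.
  have par : q (x N - x n) = 2 * q (u - x n) +
    2 * q (u - x N) - q ((u - x n) + (u - x N)).
    have := parallelogram (u - x n) (u - x N).
    rewrite !rnorm_dot -[2](rmorph_nat (real_complex R)) -!rmorphM -rmorphD
      -rmorphB.
    have -> : (u - x n) - (u - x N) = x N - x n
      by rewrite opprB addrC addrA subrK.
    exact: complexI.
  have half : 4 * m <= q ((u - x n) + (u - x N)).
    have -> : (u - x n) + (u - x N) = 2%:C *: (u - 2^-1%:C *: (x n + x N)).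
      rewrite scalerBr scalerA -rmorphM mulfV ?pnatr_eq0 //
        scale1r addrACA opprD.
      by rewrite rmorph_nat scaler_nat mulr2n.
    rewrite qC expr2 -natrM ler_pM2l // mq //.
    have := Llin 2^-1%:C _ _ (Llin 1 _ _ (xL n) (xL N)) L0.
    by rewrite addr0 scale1r.
  have := xq N; have := xq n; rewrite par.
  have : n.+1%:R^-1 <= N.+1%:R^-1 :> R by rewrite lef_pV2 ?posrE // ler_nat.
  move: half;
    move: (q _) (q _) (q _) (n.+1%:R^-1) (N.+1%:R^-1) => a b c d s *; lra.
have [|y yP] := @hilbert_cauchy x.
  move=> t t0;
    have [N NP] := invS_small (divr_gt0 (exprn_gt0 2 t0) (ltr0n _ 4)).
  exists N => n Nn; rewrite -(@ltr_pXn2r _ 2) ?nnegrE ?rnorm_ge0 ?ltW //.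
  apply: le_lt_trans (xx _ _ Nn) _; have := NP N (leqnn N).
  by rewrite ltr_pdivlMr // mulrC.
(* The limit [y] is not known to lie in [L], so orthogonality is estimated at [x n]: [dot_min]
   bounds the inner product by the excess of [q (u - x n)] over the infimum. *)
have uy : u - y = 0.
  apply: Lperp => l Ll; apply: (@norm_small R (2 * rnorm l)) => t t0.
  have [N1 P1] := yP _ t0; have [N2 P2] := invS_small (exprn_gt0 2 t0).
  pose n := maxn N1 N2.
  have h1 : rnorm (y - x n) < t by apply: P1; rewrite leq_maxl.
  have h2 : n.+1%:R^-1 < t ^+ 2 by apply: P2; rewrite leq_maxr.
  have h3 : rnorm (dot (u - x n) l) <= t * rnorm l.
    rewrite -(@ler_pXn2r _ 2) ?nnegrE ?mulr_ge0 ?rnorm_ge0 ?(ltW t0) // exprMn.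
    rewrite -lecR rmorphXn /= -rnormE rmorphM /= -rnorm_dot.
    apply: le_trans (@dot_min _ _ (u - x n) l m%:C _) _.
      move=> c; rewrite rnorm_dot lecR.
      have -> : u - x n - c *: l = u - (c *: l + x n)
        by rewrite opprD [- _ - _]addrC addrA.
      by apply: mq; exact: Llin.
    rewrite ler_wpM2r ?dot_ge0 // rnorm_dot -rmorphB lecR lerBlDl.
    by apply: ltW; apply: lt_trans (xq n) _; rewrite ltrD2l.
  have h4 : rnorm (dot (x n - y) l) <= t * rnorm l.
    rewrite (le_trans (rnorm_CS _ _)) // ler_wpM2r ?rnorm_ge0 //.
    by rewrite rnormC ltW.
  have -> : dot (u - y) l = dot (u - x n) l + dot (x n - y) l
    by rewrite -dotDl addrA subrK.
  rewrite rnormE lecR (le_trans (rnormD _ _)) //.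
  by move: h3 h4; move: (rnorm _) (rnorm _) (rnorm _) => a b c; lra.
have [N NP] := yP e e0; exists (x N) => //.
by rewrite -[u](subrK y) uy add0r NP.
Qed.

End HilbertDensity.

Section DruryArvesonClass.
Variables (R : realType) (d : nat).
Local Notation C := R[i].
Local Notation ball := (uball R d).
Variables (H : hilbertType R) (ev : H -> 'rV[C]_d -> C) (S : 'I_d -> bop H).
Hypothesis DA : drury_arveson ev.
Hypothesis shift : coordinate_shift ev S.
Local Notation dot := (@hdot R H).
Local Notation K := (@drury_arveson_kernel R d).
Implicit Types (u w : H) (v x y z : 'rV[C]_d).

Lemma rkernel_exists : exists k : 'rV[C]_d -> H, forall v, ball v ->
  (forall x, ball x -> ev (k v) x = K x v) /\ (forall u, ev u v = dot u (k v)).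
Proof.
have /choice[k kP] : forall v, exists k : H, ball v ->
    (forall x, ball x -> ev k x = K x v) /\ (forall u, ev u v = dot u k).
  move=> v; have [bv|nbv] := pselect (ball v); last by exists 0.
  by have [k kP] := rkhs_kernel DA bv; exists k.
by exists k.
Qed.

Definition rkernel := projT1 (cid rkernel_exists).
Local Notation k := rkernel.

Lemma ev_rkernel v x : ball v -> ball x -> ev (k v) x = K x v.
Proof. by move=> bv bx; have [kv _] := projT2 (cid rkernel_exists) v bv;
  exact: kv. Qed.

Lemma ev_dot u v : ball v -> ev u v = dot u (k v).
Proof. by move=> bv; have [_ kv] := projT2 (cid rkernel_exists) v bv;
  exact: kv. Qed.

Lemma dot_rkernel v x : ball v -> ball x -> dot (k v) (k x) = K x v.
Proof. by move=> bv bx; rewrite -ev_dot // ev_rkernel. Qed.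

Lemma ev_inj u w : (forall v, ball v -> ev u v = ev w v) -> u = w.
Proof.
move=> uw; apply/eqP; rewrite -subr_eq0; apply/eqP;
  apply: (rkhs_inj DA) => v bv.
by rewrite ev_dot // dotBl -!ev_dot // uw // subrr.
Qed.

(** As [^-1] sends 0 to 0, this is what permits cancelling the kernel against its denominator in
    [shift_defect]. It follows from 2 |x_j y_j| <= |x_j|^2 + |y_j|^2. *)
Lemma drury_arveson_denominator x y : ball x -> ball y ->
  1 - \sum_j x 0 j * (y 0 j)^*%R != 0.
Proof.
move=> /uballE bx /uballE b_y; rewrite subr_eq0;
  apply/eqP => /(congr1 (@rnorm R C)).
rewrite rnorm1 => e;
  have := rnorm_sum (index_enum 'I_d) xpredT (fun j => x 0 j * (y 0 j)^*%R).
rewrite -e leNgt => /negP; apply.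
apply: (@le_lt_trans _ _ ((\sum_j rnorm (x 0 j) ^+ 2 +
  \sum_j rnorm (y 0 j) ^+ 2) / 2)).
  rewrite -big_split mulr_suml; apply: ler_sum => j _ /=;
    rewrite rnormM rnorm_conj.
  move: (rnorm (x 0 j)) (rnorm (y 0 j)) => a b.
  by have := sqr_ge0 (a - b); nra.
by move: bx b_y; move: (\sum_j _) (\sum_j _) => s t; lra.
Qed.

(** Pairing [S j w] with [k v] evaluates it at [v], which multiplies the value of [w] by the scalar
    [v 0 j]. *)
Lemma shift_adjoint j v : ball v -> star (S j) (k v) = (v 0 j)^*%R *: k v.
Proof.
move=> bv; apply: dot_inj => w.
by rewrite -[LHS]adjointE -ev_dot // shift // ev_dot // dotZr conjCK.
Qed.

(* 1 - \sum_j S_j S_j^* is the projection onto the constants. *)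
Lemma shift_defect u : \sum_j rnorm (star (S j) u) ^+ 2 <= rnorm u ^+ 2.
Proof.
have b0 : ball 0 by exact: uball0.
(* The kernel times its denominator is 1, and [k 0] is the constant function 1. *)
have kv v : ball v -> k v - \sum_j (v 0 j)^*%R *: S j (k v) = k 0.
  move=> bv; apply: ev_inj => x bx;
    rewrite ev_dot // dotBl -ev_dot // !ev_rkernel //.
  have -> : dot (\sum_j (v 0 j)^*%R *: S j (k v)) (k x) =
      (\sum_j x 0 j * (v 0 j)^*%R) * K x v.
    rewrite dot_suml mulr_suml; apply: eq_bigr => j _.
    by rewrite dotZl -ev_dot // shift // ev_rkernel // mulrA [_^*%R * _]mulrC.
  rewrite -[X in X - _]mul1r -mulrBl mulfV ?drury_arveson_denominator //.
  rewrite /drury_arveson_kernel big1 ?subr0 ?invr1 // => j _.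
  by rewrite mxE conjC0 mulr0.
have defect : u - \sum_j S j (star (S j) u) = dot u (k 0) *: k 0.
  apply: ev_inj => v bv; rewrite !ev_dot // dotBl dotZl dot_rkernel //.
  have -> : K v 0 = 1.
    rewrite /drury_arveson_kernel big1 ?subr0 ?invr1 // => j _.
    by rewrite mxE conjC0 mulr0.
  rewrite mulr1 -(kv v bv) dotBr; congr (_ - _).
  rewrite dot_suml dot_sumr; apply: eq_bigr => j _ /=.
  rewrite adjointE shift_adjoint // !dotZr; congr (_ * _).
  rewrite [LHS](adjointE (star (S j)) u (k v)); congr (dot u (bop_fun _ _)).
  exact: (@starK R (bop H)).
(* Pairing with [u] turns the identity into |u|^2 - sum_j |S_j^* u|^2 = |dot u (k 0)|^2. *)
have /(congr1 (fun w => dot w u)) := defect.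
rewrite dotBl dotZl [dot (k 0) u]dotC -normCK dot_suml.
under eq_bigr do rewrite adjointE rnorm_dot.
rewrite rnorm_dot -rmorph_sum -rmorphB rnormE -rmorphXn => /complexI e.
by rewrite -subr_ge0 e sqr_ge0.
Qed.

(** [shift_defect] controls the column of the adjoints, so the estimate is made on the adjoint of
    z.S; [adjoint_bound] carries it back later. *)
Lemma DA_lincomb_norm z u : ball z ->
  rnorm (star (lincomb S z) u) <= (\sum_j rnorm (z 0 j) ^+ 2 + 1) / 2 * rnorm u.
Proof.
move=> bz; have [->|u0] := eqVneq u 0; first by rewrite linear0 !rnorm0 mulr0.
have t0 : 0 < rnorm u by rewrite lt_def rnorm_ge0 andbT;
  apply: contra_neq u0 => /rnorm0_eq0.
have -> : star (lincomb S z) u = \sum_j (z 0 j)^*%R *: star (S j) u.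
  rewrite star_sum; under eq_bigr do rewrite starZ.
  exact: (big_morph (fun X : bop H => X u)).
rewrite (le_trans (rnorm_sum _ _ _)) //; set t := rnorm u in t0 *.
(* Weighted mean inequality a b <= (t a^2 + b^2 / t) / 2; with the weight [t = rnorm u], both sums
   are at most multiples of [t]. *)
apply: (@le_trans _ _ (\sum_j (t * rnorm (z 0 j) ^+ 2 +
  rnorm (star (S j) u) ^+ 2 / t) / 2)).
  apply: ler_sum => j _; rewrite rnormZ rnorm_conj.
  move: (rnorm (z 0 j)) (rnorm (star (S j) u)) => a b.
  have -> : (t * a ^+ 2 + b ^+ 2 / t) / 2 = a * b + (t * a - b) ^+ 2 / (2 * t).
    by field; rewrite gt_eqF.
  by rewrite lerDl divr_ge0 ?sqr_ge0 // mulr_ge0 // ltW.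
rewrite -mulr_suml big_split /= -mulr_sumr -mulr_suml mulrAC ler_wpM2r
  ?invr_ge0 //.
rewrite mulrDl mul1r [t * _]mulrC lerD2l ler_pdivrMr // -expr2.
exact: shift_defect.
Qed.

Lemma DA_lincomb_lt1 z : ball z -> cnorm (lincomb (cstar_gen_elt S) z) < 1.
Proof.
move=> bz; have /uballE zb := bz; set c := (\sum_j rnorm (z 0 j) ^+ 2 + 1) / 2.
have c0 : 0 <= c by rewrite divr_ge0 // addr_ge0 // sumr_ge0 // => j _;
  exact: sqr_ge0.
have -> : cnorm (lincomb (cstar_gen_elt S) z) = opnorm (lincomb S z).
  rewrite -[LHS]/(opnorm (cstar_gen_val (lincomb (cstar_gen_elt S) z))).
  congr opnorm; exact: (big_morph (@cstar_gen_val R (bop H) 'I_d S)).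
apply: (@le_lt_trans _ _ c); last by rewrite /c; move: zb; lra.
apply: opnorm_le => // u.
have := @adjoint_bound R H (star (lincomb S z)) c;
  rewrite (_ : adjoint_fun _ = lincomb S z).
  by apply=> w; rewrite !rnormE -rmorphM lecR; exact: DA_lincomb_norm.
by rewrite -[RHS](congr1 (@bop_fun R H) (@starK R (bop H) _)).
Qed.

(** The list records an expansion and not only its sum: a vector of the span may have several
    expansions, and rotations are defined on expansions. *)
Definition kernel_comb (s : seq (C * 'rV[C]_d)) : H :=
  \sum_(p <- s) p.1 *: k p.2.

(** A vector orthogonal to every [k x] vanishes at every point of the ball. *)
Lemma kernel_comb_dense u (e : R) : 0 < e ->
  exists2 s, {in s, forall p, ball p.2} & rnorm (u - kernel_comb s) < e.
Proof.
move=> e0; pose L := [set l | exists2 s, {in s, forall p, ball p.2} & l =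
  kernel_comb s].
have [||v vL|_ [s sb ->] us] := @orthogonal_dense R H L _ _ _ u e e0;
  last by exists s.
- by exists [::] => //; rewrite /kernel_comb big_nil.
- move=> c _ _ [s sb ->] [t tb ->].
  exists ([seq (c * p.1, p.2) | p <- s] ++ t).
    by move=> p; rewrite mem_cat => /orP[/mapP[q /sb qb ->]|/tb].
  rewrite /kernel_comb big_cat /= big_map scaler_sumr; congr (_ + _).
  by apply: eq_bigr => p _; rewrite scalerA.
apply: ev_inj => x bx; rewrite !ev_dot // dot0l; apply: vL.
exists [:: (1, x)]; first by move=> p; rewrite inE => /eqP->.
by rewrite /kernel_comb big_seq1 scale1r.
Qed.

(** * Rotations of the Drury-Arveson space *)

Section Rotation.
Variable a : C.
Hypothesis a1 : rnorm a = 1.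

Let aa : a * a^*%R = 1. Proof. by rewrite -normCK rnormE a1 expr1n. Qed.

Let ba v : ball v -> ball (a *: v). Proof. by apply: uballZ; rewrite a1. Qed.

Let bac v : ball v -> ball (a^*%R *: v).
Proof. by apply: uballZ; rewrite rnorm_conj a1. Qed.

Lemma rkernel_rotate x y : K (a *: x) y = K x (a^*%R *: y).
Proof.
rewrite /drury_arveson_kernel; congr (_ - _)^-1; apply: eq_bigr => j _.
by rewrite !mxE (rmorphM (@Num.conj C)) /= conjCK mulrCA mulrA.
Qed.

(** The conjugate is the one of [rkernel_rotate]: rotating the argument of a kernel function by [a]
    rotates its base point by the conjugate. *)
Definition rotate_comb (s : seq (C * 'rV[C]_d)) :=
  [seq (p.1, a^*%R *: p.2) | p <- s].

Lemma dot_rotate_comb s t : {in s, forall p, ball p.2} ->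
  {in t, forall p, ball p.2} ->
  dot (kernel_comb (rotate_comb s)) (kernel_comb (rotate_comb t)) =
  dot (kernel_comb s) (kernel_comb t).
Proof.
move=> sb tb; rewrite /kernel_comb !big_map !dot_suml.
apply: eq_big_seq => p /sb pb; rewrite !dot_sumr;
  apply: eq_big_seq => q /tb qb /=.
rewrite !dotZl !dotZr !dot_rkernel //; try exact: bac.
by rewrite -rkernel_rotate scalerA aa scale1r.
Qed.

Lemma rnorm_rotate_comb s t : {in s, forall p, ball p.2} ->
  {in t, forall p, ball p.2} ->
  rnorm (kernel_comb (rotate_comb s) - kernel_comb (rotate_comb t)) =
  rnorm (kernel_comb s - kernel_comb t).
Proof.
move=> sb tb; apply/eqP; rewrite -(@eqrXn2 _ 2) ?rnorm_ge0 //; apply/eqP.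
by apply: complexI; rewrite -!rnorm_dot !dotBl !dotBr !dot_rotate_comb.
Qed.

Lemma ev_rotate_comb s v : {in s, forall p, ball p.2} -> ball v ->
  ev (kernel_comb (rotate_comb s)) v = ev (kernel_comb s) (a *: v).
Proof.
move=> sb bv; rewrite !ev_dot //; last exact: ba.
rewrite /kernel_comb big_map !dot_suml; apply: eq_big_seq => p /sb pb /=.
by rewrite !dotZl !dot_rkernel ?rkernel_rotate //; [exact: ba|exact: bac].
Qed.

(* The rotation is isometric on the span of the kernel functions, which is dense. *)
Lemma rotation_exists u : exists w, (forall v, ball v ->
  ev w v = ev u (a *: v)) /\
  rnorm w <= rnorm u.
Proof.
have apx n : exists s, {in s, forall p, ball p.2} /\
  rnorm (u - kernel_comb s) < n.+1%:R^-1.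
  have n0 : 0 < n.+1%:R^-1 :> R by rewrite invr_gt0.
  by have [s sb us] := kernel_comb_dense u n0; exists s.
have [s sP] := choice apx.
have sb n : {in s n, forall p, ball p.2} by case: (sP n).
have su n : rnorm (u - kernel_comb (s n)) < n.+1%:R^-1 by case: (sP n).
have [|w wP] := @hilbert_cauchy R H (fun n => kernel_comb (rotate_comb (s n))).
  move=> e e0; have [N NP] := invS_small (divr_gt0 e0 (ltr0n _ 2)).
  exists N => n Nn; rewrite rnorm_rotate_comb //.
  have -> : kernel_comb (s N) - kernel_comb (s n) =
      (u - kernel_comb (s n)) - (u - kernel_comb (s N)).
    by rewrite opprB [RHS]addrC addrA subrK.
  rewrite (le_lt_trans (rnormB _ _)) // [e]splitr.
  by apply: ltrD; [apply: lt_trans (su n) _|apply: lt_trans (su N) _];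
    apply: NP.
exists w; split=> [v bv|].
  apply/eqP; rewrite -subr_eq0; apply/eqP.
  apply: (@norm_small R (rnorm (k v) + rnorm (k (a *: v)))) => e e0.
  have [N1 P1] := wP _ e0; have [N2 P2] := invS_small e0; pose n := maxn N1 N2.
  have h1 : rnorm (w - kernel_comb (rotate_comb (s n))) < e by apply: P1;
    rewrite leq_maxl.
  have h2 : rnorm (kernel_comb (s n) - u) < e.
    by rewrite rnormC (lt_trans (su n)) // P2 // leq_maxr.
  have -> : ev w v - ev u (a *: v) =
    dot (w - kernel_comb (rotate_comb (s n))) (k v) +
      dot (kernel_comb (s n) - u) (k (a *: v)).
    rewrite !dotBl -!ev_dot //; try exact: ba.
    by rewrite (ev_rotate_comb (sb n) bv) addrA subrK.
  rewrite rnormE lecR (le_trans (rnormD _ _)) // [leRHS]mulrC mulrDr.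
  by apply: lerD;
    rewrite (le_trans (rnorm_CS _ _)) // ler_wpM2r ?rnorm_ge0 // ltW.
apply/ler_addgt0Pr => e e0; have e20 : 0 < e / 2 by rewrite divr_gt0.
have [N1 P1] := wP _ e20; have [N2 P2] := invS_small e20; pose n := maxn N1 N2.
have h1 : rnorm (w - kernel_comb (rotate_comb (s n))) < e / 2 by apply: P1;
  rewrite leq_maxl.
have h2 : rnorm (kernel_comb (s n) - u) < e / 2.
  by rewrite rnormC (lt_trans (su n)) // P2 // leq_maxr.
have h3 : rnorm (kernel_comb (rotate_comb (s n))) = rnorm (kernel_comb (s n)).
  have nil_b : {in ([::] : seq (C * 'rV[C]_d)), forall p, ball p.2} by [].
  by have := rnorm_rotate_comb (sb n) nil_b;
    rewrite /kernel_comb !big_nil !subr0.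
have := rnormD (w - kernel_comb (rotate_comb (s n))) (kernel_comb
  (rotate_comb (s n))).
have := rnormD (kernel_comb (s n) - u) u; rewrite !subrK h3.
by move: h1 h2; move: (rnorm _) (rnorm _) (rnorm _) (rnorm _) (rnorm _) => *;
  lra.
Qed.

Lemma rotation_bop_exists : exists U : bop H,
  forall u v, ball v -> ev (U u) v = ev u (a *: v).
Proof.
have /choice[U UP] := rotation_exists.
have Uev u v : ball v -> ev (U u) v = ev u (a *: v) by case: (UP u) => + _;
  exact.
(* The vectors [U u] were chosen independently of each other; linearity holds because values on the
   ball determine them. *)
have Ulin : linear U.
  move=> c u w; apply: ev_inj => v bv.
  by rewrite (rkhs_linear DA) // !Uev // (rkhs_linear DA) //; exact: ba.
have Ubnd : exists c : R, forall u, `|U u| <= c%:C * `|u|.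
  by exists 1 => u; rewrite mul1r !rnormE lecR; case: (UP u).
by exists (Bop Ulin Ubnd).
Qed.

End Rotation.

Lemma rotation_unitary (a : C) : rnorm a = 1 -> exists U : bop H,
  [/\ star U * U = 1, U * star U = 1 & forall j, U * S j * star U = a *: S j].
Proof.
move=> a1; have aa : a * a^*%R = 1 by rewrite -normCK rnormE a1 expr1n.
have ac1 : rnorm a^*%R = 1 by rewrite rnorm_conj.
have ba v : ball v -> ball (a *: v) by apply: uballZ; rewrite a1.
have bac v : ball v -> ball (a^*%R *: v) by apply: uballZ; rewrite ac1.
have [U UE] := rotation_bop_exists a1; have [W WE] := rotation_bop_exists ac1.
(* [U] maps [k v] to the kernel function at the conjugate rotation of [v], so its adjoint evaluates
   there, as [W] does. *)
have UW : star U = W.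
  apply: bopP => w; apply: ev_inj => v bv; rewrite WE // !ev_dot //;
    last exact: bac.
  have Uk : U (k v) = k (a^*%R *: v).
    apply: ev_inj => x bx; rewrite UE // !ev_rkernel ?rkernel_rotate //.
      exact: bac.
    exact: ba.
  by rewrite -Uk [LHS](adjointE (star U)); congr (dot w (bop_fun _ _));
    exact: (@starK R (bop H)).
exists U; rewrite UW; split=> [||j]; apply: bopP => u; apply: ev_inj => v bv.
- by rewrite bopM WE // UE ?scalerA ?aa ?scale1r //; exact: bac.
- by rewrite bopM UE // WE ?scalerA ?[_ * a]mulrC ?aa ?scale1r //; exact: ba.
rewrite !bopM UE // shift ?WE //; try exact: ba.
rewrite scalerA [a^*%R * a]mulrC aa scale1r mxE.
have -> : ev ((a *: S j) u) v = a * ev (S j u) v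
  by rewrite bopZ ev_dot // dotZl -ev_dot.
by rewrite shift // mulrA.
Qed.

(** * The gauge action on the C*-algebra generated by the shifts *)

Local Notation TS := (cstar_gen_type S).

(** [U] need not lie in the generated algebra. The elements whose conjugate by [U] lies in it form a
    C*-subalgebra containing every [S j], hence the whole algebra, so conjugation restricts to
    it. *)
Lemma cstar_gen_gauge (a : C) : rnorm a = 1 ->
  exists2 Phi : {lrmorphism TS -> TS},
    (forall x : TS, Phi (star x) = star (Phi x)) &
    forall j, Phi (cstar_gen_elt S j) = a *: cstar_gen_elt S j.
Proof.
move=> a1; have [U [U1 U2 US]] := rotation_unitary a1.
have [D1 DL DM DS DC] := cstar_genP S.
have conjM (x y : bop H) : U * (x * y) * star U =
  U * x * star U * (U * y * star U).
  by rewrite !mulrA -[_ * star U * U]mulrA U1 mulr1.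
have conjL c (x y : bop H) : U * (c *: x +
  y) * star U = c *: (U * x * star U) + U * y * star U.
  by rewrite mulrDr mulrDl -scalerAr -scalerAl.
have conjS (x : bop H) : U * star x * star U = star (U * x * star U).
  by rewrite !starM starK mulrA.
have genU (x : bop H) : cstar_gen S x -> cstar_gen S (U * x * star U).
  move=> /(_ [set y | cstar_gen S (U * y * star U)]); apply; split; last first.
    move=> _ [j _ <-] /=; rewrite US -[_ *: _]addr0; apply: (DL).
      by move=> D [_]; apply; exists j.
    by have := DL (-1) _ _ D1 D1; rewrite scaleN1r addNr.
  split=> /=.
  - by rewrite mulr1 U2.
  - by move=> c x' y Dx Dy; rewrite conjL; exact: DL.
  - by move=> x' y Dx Dy; rewrite conjM; exact: DM.
  - by move=> x' Dx; rewrite conjS; exact: DS.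
  move=> x' xC; apply: DC => e e0.
  pose c := cnorm U * cnorm (star U) + 1.
  have c0 : 0 < c by rewrite ltr_wpDl // mulr_ge0 // cstar_cnorm_ge0.
  have [y Dy xy] := xC _ (divr_gt0 e0 c0); exists (U * y * star U) => //.
  rewrite -mulrBl -mulrBr; apply: le_lt_trans (cnormM _ _) _.
  apply: le_lt_trans (ler_wpM2r (cstar_cnorm_ge0 _) (cnormM _ _)) _.
  rewrite ltr_pdivlMr // in xy; apply: le_lt_trans xy.
  rewrite mulrAC mulrC ler_wpM2l ?cstar_cnorm_ge0 //.
  by rewrite lerDl.
have memU (x : TS) : U * cstar_gen_val x * star U \in cstar_gen_pred S.
  by case: x => x /= /asboolP Dx; apply/asboolP; exact: genU.
pose Phi (x : TS) : TS := CStarGen (memU x).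
have Phi_lin : linear Phi by move=> c x y; apply: val_inj; exact: conjL.
have Phi_mul : monoid_morphism Phi.
  by split=> [|x y]; apply: val_inj => /=; [rewrite mulr1 U2|exact: conjM].
pose l := GRing.isLinear.Build C TS TS *:%R Phi Phi_lin.
pose mm := GRing.isMonoidMorphism.Build TS TS Phi Phi_mul.
pose P : {lrmorphism TS -> TS} := HB.pack Phi l mm.
by exists P => [x|j]; apply: val_inj; [exact: conjS|exact: US].
Qed.

Lemma positive_class_drury_arveson : positive_class (herglotz_class
  (cstar_gen_elt S)).
Proof.
exact: (positive_class_herglotz (cstarAlg_norm TS) DA_lincomb_lt1
  cstar_gen_gauge).
Qed.

End DruryArvesonClass.

(* The dimension is d = n.+1. *)
Theorem theorem3p2 (R : realType) (n : nat)
  (H2 : hilbertType R) (ev : H2 -> 'rV[R[i]]_n.+1 -> R[i])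
  (S : 'I_n.+1 -> bop H2)
  (On : cstarAlgType R) (V : 'I_n.+1 -> On) :
  drury_arveson ev -> coordinate_shift ev S -> cuntz_algebra V ->
  [/\ positive_class (herglotz_class (@sphere_coord R n)),
      positive_class (herglotz_class (cstar_gen_elt S)) &
      positive_class (herglotz_class V)].
Proof.
move=> DA shift Vcuntz; split.
- exact: positive_class_sphere.
- exact: (positive_class_drury_arveson DA shift).
- exact: positive_class_cuntz.
Qed.
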